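(* Let $A$ be an algebra, $L:A\to\mathbb{R}$ linear with $L(1)=1$, and $K\subseteq X(A)$ closed. Write $K=K_Q$ for some quadratic module $Q$ in $A$ (this is always possible). (i) There exists an $X(A)$-representing measure $\mu$ for $L$ on the cylinder $\sigma$-algebra $\Sigma_I$ supported on each $\pi_S^{-1}(K_{Q\cap S})$ with $S\in I$ if and only if for every $S\in I$ there exists a $K_{Q\cap S}$-representing Radon measure $\mu_S$ for $L|_S$ such that $\{\mu_S:S\in I\}$ is an exact projective system and the corresponding exact projective system $\{\mu_T:T\in\Lambda\}$ is thick. Moreover, if $Q$ is countably generated, then $\mu$ is a $K$-representing measure for $L$ on $\Sigma_I$. (ii) There exists a $K$-representing Radon measure $\nu$ for $L$ if and only if for every $S\in I$ there exists a $K_{Q\cap S}$-representing Radon measure $\mu_S$ for $L|_S$ such that $\{\mu_S:S\in I\}$ fulfills Prokhorov's condition.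
   Context: All algebras are unital commutative real algebras, subalgebras contain the unit, and $X(A)\neq\emptyset$. For an algebra $S$, $X(S)$ is the set of unital $\mathbb{R}$-algebra homomorphisms $S\to\mathbb{R}$ (characters), with the weakest topology $\tau_{X(S)}$ such that for all $a\in S$ the function $\hat a:X(S)\to\mathbb{R}$, $\hat a(\alpha)=\alpha(a)$, is continuous; $\mathcal{B}_{X(S)}$ is its Borel $\sigma$-algebra. For subalgebras $S\subseteq T$ of $A$, $\pi_{S,T}:X(T)\to X(S)$ is the restriction map and $\pi_S:=\pi_{S,A}$. $I$ is the set of all finitely generated subalgebras of $A$ and $\Lambda$ the set of all countably generated subalgebras of $A$, both ordered by inclusion. The cylinder $\sigma$-algebra $\Sigma_I$ is the smallest $\sigma$-algebra on $X(A)$ such that all $\pi_S:X(A)\to (X(S),\mathcal{B}_{X(S)})$, $S\in I$, are measurable. A quadratic module in $A$ is a subset $Q\subseteq A$ with $1\in Q$, $Q+Q\subseteq Q$ and $a^2Q\subseteq Q$ for all $a\in A$; it is generated by $G\subseteq A$ if it is the smallest quadratic module containing $G$, and countably generated if $G$ can be taken countable. $K_Q:=\{\alpha\in X(A):\alpha(a)\ge0\ \forall a\in Q\}$, and for $S\in I$, $K_{Q\cap S}:=\{\alpha\in X(S):\alpha(a)\ge 0\ \forall a\in Q\cap S\}$. Representing measures: for an algebra $B$, $\ell:B\to\mathbb{R}$ linear, a $\sigma$-algebra $\Sigma$ on $X(B)$ and $K\in\Sigma$, a $K$-representing measure for $\ell$ on $\Sigma$ is a measure $\nu$ on $\Sigma$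 supported in $K$, i.e. $\nu(X(B)\setminus K)=0$, with $\ell(a)=\int_{X(B)}\alpha(a)\,d\nu(\alpha)$ for all $a\in B$. A Radon measure on a Hausdorff space is a Borel measure that is locally finite and inner regular with respect to compact sets (on all Borel sets). A $K$-representing Radon measure is a $K$-representing measure on $\mathcal{B}_{X(B)}$ that is Radon. Exact systems: a family $\{\mu_S:S\in I\}$ of measures $\mu_S$ on $\mathcal{B}_{X(S)}$ is an exact projective system if $(\pi_{S,T})_\#\mu_T=\mu_S$ (pushforward) for all $S\subseteq T$ in $I$; similarly for $\Lambda$. If $\{\mu_S:S\in I\}$ is an exact projective system of Radon probability measures, then for every $T\in\Lambda$ there is a unique Radon probability measure $\mu_T$ on $\mathcal{B}_{X(T)}$ with $(\pi_{S,T})_\#\mu_T=\mu_S$ for all $S\in I$ with $S\subseteq T$, and $\{\mu_T:T\in\Lambda\}$ is an exact projective system, called the corresponding one. It is called thick if for every $T\in\Lambda$, $\mu_T(M)=0$ for all $M\in\mathcal{B}_{X(T)}$ with $\pi_T(X(A))\cap M=\emptyset$. Prokhorov's condition for a family $\{\mu_S:S\in I\}$ of Radon probability measures on the $X(S)$: for every $\varepsilon>0$ there is a compact $C_\varepsilon\subset X(A)$ such that $\mu_S(\pi_S(C_\varepsilon))\ge 1-\varepsilon$ for all $S\in I$. *)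

(* Defs.v *)
From HB Require Import structures.
From mathcomp Require Import all_boot all_order all_algebra.
From mathcomp Require Import all_classical all_reals all_analysis.

Set Implicit Arguments.
Unset Strict Implicit.
Unset Printing Implicit Defensive.

Import Order.TTheory GRing.Theory Num.Theory.
Import numFieldNormedType.Exports.

Local Open Scope classical_set_scope.
Local Open Scope ring_scope.

(* Commutative unital algebras with at least one character. The mixin is a
   proposition and fixes no character; it is part of the structure because
   a [measurableType] is pointed, so character spaces need a canonical point. *)
HB.mixin Record ComAlgebra_hasCharacter (R : realType) B of GRing.ComAlgebra R B
  := { has_character : [set: {lrmorphism B -> R | *%R}] !=set0 }.

#[short(type="charAlgType")]
HB.structure Definition CharAlgebra (R : realType) :=
  {B of GRing.ComAlgebra R B & ComAlgebra_hasCharacter R B}.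

Definition character (R : realType) (B : charAlgType R) : Type :=
  {lrmorphism B -> R | *%R}.

Section CharacterSpace.
Context {R : realType} {B : charAlgType R}.

HB.instance Definition _ := gen_eqMixin (character B).
HB.instance Definition _ := gen_choiceMixin (character B).
HB.instance Definition _ :=
  isPointed.Build (character B) (projT1 (cid (@has_character R B))).

Definition hat (a : B) (chi : character B) : R := chi a.

(* The weakest topology making every [hat a] continuous. *)
HB.instance Definition _ := Topological.copy (character B)
  (sup_topology (fun a : B => Topological.on (initial_topology (hat a)))).

Definition nonneg_characters (P : set B) : set (character B) :=
  [set chi | forall a, P a -> 0 <= hat a chi].

End CharacterSpace.

Notation borel T := (g_sigma_algebraType (@open T)).

Section Measures.
Context {R : realType}.

(* Only used on character spaces, which are Hausdorff. *)
Definition radon (T : ptopologicalType)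
    (mu : {measure set (borel T) -> \bar R}) : Prop :=
  (forall x : T, exists U : set T, [/\ open U, U x & (mu U < +oo)%E]) /\
  (forall M : set (borel T), measurable M ->
     mu M = ereal_sup [set mu C | C in [set C : set T | compact C /\ C `<=` M]]).

(* [nu] is a [K]-representing measure for [ell] on the sigma-algebra
   generated by [G]. *)
Definition representing (B : charAlgType R) (G : set (set (character B)))
    (ell : B -> R) (K : set (character B))
    (nu : {measure set (g_sigma_algebraType G) -> \bar R}) : Prop :=
  [/\ G.-sigma.-measurable K,
      nu (~` K) = 0%E &
      forall a : B,
        nu.-integrable setT (fun chi : g_sigma_algebraType G => (hat a chi)%:E)
        /\ (ell a)%:E = (\int[nu]_chi (hat a chi)%:E)%E].

End Measures.

Section Subalgebras.
Context {R : realType} {A : charAlgType R}.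

Definition subalg (S : subalgClosed A) : Type := {x : A | x \in S}.

Section Instances.
Variable S : subalgClosed A.

HB.instance Definition _ := SubChoice.on (subalg S).
HB.instance Definition _ := [SubChoice_isSubAlgebra of subalg S by <:].
HB.instance Definition _ := [SubNzRing_isSubComNzRing of subalg S by <:].
HB.instance Definition _ := GRing.ComAlgebra.on (subalg S).

Definition emb (x : subalg S) : A := val x.

HB.instance Definition _ := GRing.RMorphism.copy emb
  ((val : subalg S -> A) : {rmorphism subalg S -> A}).
HB.instance Definition _ := GRing.Linear.copy emb
  ((val : subalg S -> A) : {linear subalg S -> A}).

Lemma subalg_has_character : [set: {lrmorphism subalg S -> R | *%R}] !=set0.
Proof.
have [chi _] := @has_character R A.
by exists (chi \o emb).
Qed.

HB.instance Definition _ :=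
  ComAlgebra_hasCharacter.Build R (subalg S) subalg_has_character.

End Instances.

Arguments emb S x : clear implicits.

Section Inclusion.
Variables (S T : subalgClosed A) (sST : {subset S <= T}).

Definition incl (x : subalg S) : subalg T := Sub (val x) (sST (valP x)).

Lemma incl_zmod_morphism : zmod_morphism incl.
Proof. by move=> x y; apply: val_inj. Qed.

Lemma incl_monoid_morphism : monoid_morphism incl.
Proof. by split=> [|x y]; apply: val_inj. Qed.

Lemma incl_scalable : scalable incl.
Proof. by move=> k x; apply: val_inj. Qed.

HB.instance Definition _ :=
  GRing.isZmodMorphism.Build (subalg S) (subalg T) incl incl_zmod_morphism.
HB.instance Definition _ :=
  GRing.isMonoidMorphism.Build (subalg S) (subalg T) incl incl_monoid_morphism.
HB.instance Definition _ :=
  GRing.isScalable.Build R (subalg S) (subalg T) *:%R incl incl_scalable.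

End Inclusion.

Definition res (S : subalgClosed A) (chi : character A) :
  character (subalg S) := chi \o emb S.

Definition res_sub (S T : subalgClosed A) (sST : {subset S <= T})
    (chi : character (subalg T)) : character (subalg S) := chi \o incl sST.

Arguments res S chi : clear implicits.

Definition inter_subalg (P : set A) (S : subalgClosed A) : set (subalg S) :=
  [set x | P (emb S x)].

Definition subalg_generated (G : set A) : set A :=
  smallest (fun D : set A => GRing.subalg_closed [pred x | x \in D]) G.

Definition fin_gen : set (subalgClosed A) :=
  [set S | exists2 G : set A, finite_set G & [set` S] = subalg_generated G].

Definition count_gen : set (subalgClosed A) :=
  [set S | exists2 G : set A, countable G & [set` S] = subalg_generated G].

Definition quadratic_module (Q : set A) : Prop :=
  [/\ Q 1, forall a b, Q a -> Q b -> Q (a + b)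
         & forall a b, Q b -> Q (a ^+ 2 * b)].

Definition count_gen_qm (Q : set A) : Prop :=
  exists2 G : set A, countable G & Q = smallest quadratic_module G.

(* A generating family of the cylinder sigma-algebra. *)
Definition cylinder : set (set (character A)) :=
  [set C | exists2 S, fin_gen S &
     exists2 M : set (borel (character (subalg S))),
       measurable M & C = res S @^-1` M].

(* Families of measures are indexed by all subalgebras; every condition below
   only looks at the indices in the relevant set of subalgebras. *)
Definition measure_family : Type := forall S : subalgClosed A,
  {measure set (borel (character (subalg S))) -> \bar R}.

Definition exact_system (I : set (subalgClosed A)) (mu : measure_family) :=
  forall (S T : subalgClosed A) (sST : {subset S <= T}), I S -> I T ->
    forall M : set (borel (character (subalg S))), measurable M ->
      pushforward (mu T) (res_sub sST : borel _ -> borel _) M = mu S M.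

(* [nu] is the exact projective system on the countably generated subalgebras
   corresponding to [mu]; it is determined by [mu] on all Borel sets. *)
Definition corresponding_system (mu nu : measure_family) : Prop :=
  exact_system count_gen nu /\
  forall T : subalgClosed A, count_gen T ->
    [/\ radon (nu T), nu T setT = 1%E &
        forall (S : subalgClosed A) (sST : {subset S <= T}), fin_gen S ->
        forall M : set (borel (character (subalg S))), measurable M ->
          pushforward (nu T) (res_sub sST : borel _ -> borel _) M = mu S M].

Definition thick (nu : measure_family) : Prop :=
  forall T : subalgClosed A, count_gen T ->
  forall M : set (borel (character (subalg T))), measurable M ->
    range (res T) `&` M = set0 -> nu T M = 0%E.

Definition prokhorov (mu : measure_family) : Prop :=
  forall eps : R, 0 < eps ->
    exists2 C : set (character A), compact C &
      forall S : subalgClosed A, fin_gen S ->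
        ((1 - eps)%:E <= mu S (res S @` C))%E.

End Subalgebras.

Arguments emb {R A} S x.
Arguments res {R A} S chi.
Arguments inter_subalg {R A} P S x.
Arguments cylinder {R} A.
Arguments measure_family {R} A.

(* Main.v *)
(** Part (i). A measure on the cylinder sigma-algebra pushes forward to every
    X(T), T countably generated, because X(T) has a countable base of boxes; X(T)
    is Polish, so these images are Radon. Conversely, for B in X(A) the numbers
    nu_T^*(pi_T(B)) decrease as T grows, and their infimum over countably
    generated T is an outer measure for which cylinder sets are Caratheodory
    measurable; thickness says exactly that it takes the value mu_S(M) on
    pi_S^-1(M).

    Part (ii). Given Prokhorov's condition, let m(B) be the limit of
    mu_S^*(pi_S(B)) along an ultrafilter of finitely generated S. This finitely
    subadditive set function is tight and closed cylinders are Caratheodory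
    measurable for it, which suffices to build a Radon probability measure nu with
    nu(W) <= m(W) for open W. Layer-cake summation gives
    int c^2 dnu <= L(c^2) + 1 for all c; replacing c by a + s with s real forces
    int a dnu = L(a). The support condition holds since {a < 0} is m-null for
    a in Q and a compact subset of the complement of K is covered by finitely many
    of these sets. *)
Require Import Defs.
From HB Require Import structures.
From mathcomp Require Import all_boot all_order all_algebra.
From mathcomp Require Import finmap.
From mathcomp Require Import lra.
From mathcomp Require Import all_classical all_reals all_analysis.
From mathcomp Require Import measurable_realfun.

Set Implicit Arguments.
Unset Strict Implicit.
Unset Printing Implicit Defensive.

Import Order.TTheory GRing.Theory Num.Theory.
Import numFieldNormedType.Exports.

Local Open Scope classical_set_scope.
Local Open Scope ring_scope.

(** * Outer measures and Radon measures from finitely subadditive contents *)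

Section ExtendedReals.
Context {R : realType}.
Implicit Types (S : set (\bar R)) (b c : \bar R).
Local Open Scope ereal_scope.

(** Subtracting [b] requires it to be finite. When [c] is finite this follows from one nonnegative
    member of [S], since an infinite [b] would force [c] to be infinite. *)
Lemma ge_ereal_supD S b c : (forall x, S x -> 0 <= x) -> S !=set0 -> 0 <= b ->
  (forall x, S x -> x + b <= c) -> ereal_sup S + b <= c.
Proof.
move=> S0 [x0 Sx0] b0 Sc; have [->|cy] := eqVneq c +oo; first by rewrite leey.
have bfin : b \is a fin_num.
  rewrite ge0_fin_numE// ltey; apply: contra cy => /eqP by_.
  have := Sc _ Sx0; rewrite by_ addey ?leye_eq//.
  by have := S0 _ Sx0; case: (x0).
by rewrite -leeBrDr//; apply: ge_ereal_sup => x Sx; rewrite leeBrDr//; exact: Sc.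
Qed.

Lemma le_ereal_infD S b c : b \is a fin_num ->
  (forall x, S x -> c <= x + b) -> c <= ereal_inf S + b.
Proof.
move=> bfin Sc; rewrite -leeBlDr//.
by apply: le_ereal_inf_tmp => x Sx; rewrite leeBlDr//; exact: Sc.
Qed.

End ExtendedReals.

Lemma measurable_fun_g_sigma d (X : measurableType d) (T : pointedType)
    (G : set (set T)) (f : X -> T) :
  (forall B, G B -> measurable (f @^-1` B)) ->
  measurable_fun setT (f : X -> g_sigma_algebraType G).
Proof.
move=> mf _ B mB; rewrite setTI.
apply: (smallest_sub (X := [set B | measurable (f @^-1` B)]) _ _ mB) => //.
split=> /= [|C mC|F mF]; first by rewrite preimage_set0.
  by rewrite setTD preimage_setC; exact: measurableC.
by rewrite preimage_bigcup; exact: bigcup_measurable.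
Qed.

Section OuterMeasures.
Context {R : realType}.
Local Open Scope ereal_scope.

(** The Caratheodory sets form a sigma-algebra containing [G], so the identity out of
    [caratheodory_type om] is measurable. Pushing forward along it keeps the values of [om] on every
    set, measurable or not. *)
Lemma caratheodory_restriction (T : pointedType)
    (om : {outer_measure set T -> \bar R}) (G : set (set T)) :
  (forall B, G B -> om.-caratheodory B) ->
  exists nu : {measure set (g_sigma_algebraType G) -> \bar R},
    forall B : set T, nu B = om B.
Proof.
move=> Gcara.
pose phi : caratheodory_type om -> g_sigma_algebraType G := idfun.
have mphi : measurable_fun setT phi.
  exact: measurable_fun_g_sigma.
by unshelve eexists (pushforward (om : set (caratheodory_type om) -> _) phi).
Qed.

Section ImageOuterMeasure.
Context {d} {X : Type} {Y : measurableType d} (f : X -> Y).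
Variable mu : {measure set Y -> \bar R}.

Definition image_outer (B : set X) : \bar R := mu_ext mu (f @` B).

Lemma image_outer0 : image_outer set0 = 0.
Proof. by rewrite /image_outer image_set0 outer_measure0. Qed.

Lemma image_outer_ge0 B : 0 <= image_outer B.
Proof. exact: outer_measure_ge0. Qed.

Lemma le_image_outer : {homo image_outer : B C / B `<=` C >-> B <= C}.
Proof. by move=> B C BC; apply: le_outer_measure; exact: image_subset. Qed.

Lemma image_outer_sigma_subadditive : sigma_subadditive image_outer.
Proof.
by move=> F; rewrite /image_outer image_bigcup; exact: outer_measure_sigma_subadditive.
Qed.

HB.instance Definition _ := isOuterMeasure.Build R X image_outer
  image_outer0 image_outer_ge0 le_image_outer image_outer_sigma_subadditive.

(** The image of the part of [D] inside (outside) the preimage of [M] lies in the part of the image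
    of [D] inside (outside) [M], and [M] splits the latter exactly. *)
Lemma image_outer_caratheodory (M : set Y) :
  measurable M -> image_outer.-caratheodory (f @^-1` M).
Proof.
move=> mM; apply: le_caratheodory_measurable => D.
rewrite /image_outer [leRHS](sub_caratheodory mu (sub_gen_smallest mM)) leeD//.
  by apply: le_outer_measure => _ [x [Dx Mx] <-]; split => //; exists x.
by apply: le_outer_measure => _ [x [Dx Mx] <-]; split => //; exists x.
Qed.

Lemma image_outer_le (M : set Y) (B : set X) :
  measurable M -> B `<=` f @^-1` M -> image_outer B <= mu M.
Proof.
move=> mM BM; rewrite -(measurable_mu_extE mu mM).
by apply: le_outer_measure => _ [x /BM + <-].
Qed.

(** A countable measurable cover may be replaced by its union, so lower bounds need only be tested
    on single measurable supersets. *)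
Lemma image_outer_ge (c : \bar R) (B : set X) :
  (forall M, measurable M -> B `<=` f @^-1` M -> c <= mu M) ->
  c <= image_outer B.
Proof.
move=> cM; apply: le_ereal_inf_tmp => _ [F [mF BF] <-].
have mU : measurable (\bigcup_k F k) by exact: bigcup_measurable.
apply: (@le_trans _ _ (mu (\bigcup_k F k))).
  by apply: cM => // x Bx; apply: BF; exists x.
exact: measure_sigma_subadditive.
Qed.

End ImageOuterMeasure.
End OuterMeasures.
(** Induction over compact sets: a property stable under binary unions only has to be checked
    locally. The interiors of the sets with [P] cover [C], and a finite subcover is glued. *)
Lemma compact_ind (T : ptopologicalType) (C : set T) (P : set T -> Prop) :
  compact C -> P set0 -> (forall U V, P U -> P V -> P (U `|` V)) ->
  (forall x, C x -> exists2 V, nbhs x V & P V) ->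
  exists2 V, P V & C `<=` interior V.
Proof.
move=> cC P0 PU CP.
have : finite_subset_cover [set V | P V] interior C.
  move: cC; rewrite compact_cover; apply.
    by move=> V _; exact: open_interior.
  by move=> x /CP[V xV PV]; exists V.
case=> D PD CD.
have PE V : V \in D -> P V by move=> /PD; rewrite inE.
exists (\big[setU/set0]_(V <- D) V).
  by rewrite big_seq; apply: big_ind => // V; exact: PE.
move=> x /CD[V /= VD xV]; move: xV; apply: interiorS => y Vy.
by rewrite -bigcup_seq; exists V.
Qed.

(** * Regularisation of a tight, finitely subadditive content *)

Section RadonOfContent.
Context {R : realType} {T : ptopologicalType}.
Local Open Scope ereal_scope.
Variable m : set T -> \bar R.
Hypothesis hT : hausdorff_space T.
Hypothesis m0 : m set0 = 0.
Hypothesis le_m : {homo m : B C / B `<=` C >-> B <= C}.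
Hypothesis mU : forall B C, m (B `|` C) <= m B + m C.
Hypothesis mT : m setT <= 1.
Hypothesis m_regular : forall (W : set T) x, open W -> W x ->
  exists V, [/\ nbhs x V, closed V, V `<=` W & m.-caratheodory V].
Hypothesis m_tight : forall e : R, (0 < e)%R ->
  exists2 C, compact C & (1 - e)%:E <= m C.

Let m_ge0 B : 0 <= m B.
Proof. by rewrite -m0 le_m. Qed.

(* [inner_content] is the regularised content of a compact set, from which the
   measure is obtained as usual: inner regularity gives [open_content], outer
   regularity gives the outer measure [content_outer]. *)
Definition inner_content (C : set T) : \bar R :=
  ereal_inf [set m V | V in [set V | open V /\ C `<=` V]].
Local Notation lam := inner_content.

Definition open_content (W : set T) : \bar R :=
  ereal_sup [set lam C | C in [set C | compact C /\ C `<=` W]].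
Local Notation rho := open_content.

Definition content_outer (B : set T) : \bar R :=
  ereal_inf [set rho W | W in [set W | open W /\ B `<=` W]].
Local Notation nus := content_outer.

Let lam_ge0 C : 0 <= lam C.
Proof. by apply: le_ereal_inf_tmp => _ [V _ <-]. Qed.

Let lam_le C V : open V -> C `<=` V -> lam C <= m V.
Proof. by move=> oV CV; apply: ereal_inf_lbound; exists V. Qed.

Let lam_le1 C : lam C <= 1.
Proof. by apply: le_trans mT; apply: lam_le => //; exact: openT. Qed.

Let ge_lam C : m C <= lam C.
Proof. by apply: le_ereal_inf_tmp => _ [V [_ CV] <-]; exact: le_m. Qed.

Let le_lam C D : C `<=` D -> lam C <= lam D.
Proof.
move=> CD; apply: le_ereal_inf_tmp => _ [V [oV DV] <-].
by apply: lam_le => //; exact: subset_trans DV.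
Qed.

Let lam_fin C : lam C \is a fin_num.
Proof. by rewrite ge0_fin_numE// (le_lt_trans (lam_le1 _))// ltry. Qed.

Let m_fin B : m B \is a fin_num.
Proof.
by rewrite ge0_fin_numE// (le_lt_trans (le_m (@subsetT _ B)))// (le_lt_trans mT)// ltry.
Qed.

Let lam0 : lam set0 = 0.
Proof. by apply/eqP; rewrite eq_le lam_ge0 andbT -m0 lam_le//; exact: open0. Qed.

Let lamU C D : lam (C `|` D) <= lam C + lam D.
Proof.
apply: le_ereal_infD => // _ [V [oV CV] <-].
rewrite addeC; apply: le_ereal_infD => // _ [W [oW DW] <-].
rewrite addeC (le_trans _ (mU _ _))//.
by apply: lam_le; [exact: (openU oV oW)|exact: setUSS].
Qed.

Let lam_bigU (F : (set T)^nat) n :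
  lam (\big[setU/set0]_(i < n) F i) <= \sum_(i < n) lam (F i).
Proof.
elim: n => [|n IH]; first by rewrite !big_ord0 lam0.
by rewrite !big_ord_recr/= (le_trans (lamU _ _))// leeD2r.
Qed.

Let cara0 : m.-caratheodory set0.
Proof. by move=> X; rewrite setI0 setC0 setIT m0 add0e. Qed.

Let caraU V W : m.-caratheodory V -> m.-caratheodory W ->
  m.-caratheodory (V `|` W).
Proof.
move=> cV cW X; apply/eqP; rewrite eq_le; apply/andP; split.
  by rewrite (le_trans _ (mU _ _))// -setIUr setUCr setIT.
(* Cut by [V], then cut the part outside [V] by [W]; the two pieces inside the union are recombined
   by subadditivity. *)
rewrite [leRHS]cV [X in _ <= _ + X]cW setCU setIA addeA leeD2r//.
apply: le_trans (mU _ _); apply: le_m => x [Xx]; have [Vx _|nVx [//|Wx]] := pselect (V x).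
  by left.
by right.
Qed.

(** Supplies the cutting sets for additivity on disjoint compact sets: [m] splits exactly along
    Caratheodory sets, [m_regular] gives these locally, and [caraU] preserves them under the finite
    unions that cover [C]. *)
Let separation C F : compact C -> closed F -> C `&` F = set0 ->
  exists V, [/\ closed V, m.-caratheodory V, V `&` F = set0 & C `<=` interior V].
Proof.
move=> cC cF CF.
have [||x Cx|V [cV mV VF] CV] := @compact_ind T C
  (fun V => [/\ closed V, m.-caratheodory V & V `&` F = set0]) cC.
- by split; [exact: closed0|exact: cara0|rewrite set0I].
- move=> U V [cU mU' UF] [cV mV VF]; split; [exact: closedU|exact: caraU|].
  by rewrite setIUl UF VF setU0.
- have [||V [xV cV VF mV]] := m_regular (W := ~` F) (x := x).
  + exact: closed_openC.
  + by move=> Fx; have : (C `&` F) x by []; rewrite CF.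
  by exists V => //; split=> //; exact/disjoints_subset.
by exists V.
Qed.

(** An open [W] around both sets is cut by the closed set [V]: inside [W], the interior of [V] is an
    open neighbourhood of [C] and the complement of [V] one of [D]. *)
Let lamUD C D : compact C -> compact D -> C `&` D = set0 ->
  lam C + lam D <= lam (C `|` D).
Proof.
move=> cC cD CD; have clD := compact_closed hT cD.
have [V [cV mV VD CV]] := separation cC clD CD.
apply: le_ereal_inf_tmp => _ [W [oW CDW] <-].
rewrite [leRHS](mV W) leeD//.
  apply: (@le_trans _ _ (m (W `&` interior V))); last first.
    by apply: le_m; apply: setIS; exact: interior_subset.
  apply: lam_le; first by apply: openI => //; exact: open_interior.
  by move=> x Cx; split; [apply: CDW; left|exact: CV].
apply: lam_le; first by apply: openI => //; exact: closed_openC.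
move=> x Dx; split; first by apply: CDW; right.
by move=> Vx; have : (V `&` D) x by []; rewrite VD.
Qed.

Let rho_ge C W : compact C -> C `<=` W -> lam C <= rho W.
Proof. by move=> cC CW; apply: ereal_sup_ubound; exists C. Qed.

Let rho_ge0 W : 0 <= rho W.
Proof. by rewrite -lam0 rho_ge//; exact: compact0. Qed.

Let rho_le1 W : rho W <= 1.
Proof. by apply: ge_ereal_sup => _ [C _ <-]. Qed.

Let rho_le_m W : open W -> rho W <= m W.
Proof. by move=> oW; apply: ge_ereal_sup => _ [C [_ CW] <-]; exact: lam_le. Qed.

Let le_rho W V : W `<=` V -> rho W <= rho V.
Proof.
move=> WV; apply: ge_ereal_sup => _ [C [cC CW] <-].
by apply: rho_ge => //; exact: subset_trans WV.
Qed.

(** By compactness, [C] is covered by finitely many closed sets [F i] contained in [W i]. The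
    intersections of [C] with them are compact, so finite subadditivity of [lam] applies. *)
Let rho_sigma_subadditive (W : (set T)^nat) : (forall n, open (W n)) ->
  rho (\bigcup_n W n) <= \sum_(i <oo) rho (W i).
Proof.
move=> oW; apply: ge_ereal_sup => _ [C [cC CW] <-].
pose P V := exists n (F : (set T)^nat),
  (forall i, closed (F i) /\ F i `<=` W i) /\ V `<=` \big[setU/set0]_(i < n) F i.
have [||x Cx|V [n [F [FW VF]]] CV] := @compact_ind T C P cC.
- by exists 0%N, (fun=> set0); split=> // i; split; [exact: closed0|].
- move=> U V [n [F [FW UF]]] [k [G [GW VG]]].
  (* Extending both families to length [n + k] allows joining them index by index. *)
  exists (n + k)%N, (fun i => F i `|` G i); split.
    move=> i; have [cF FWi] := FW i; have [cG GWi] := GW i.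
    by split; [exact: closedU|rewrite subUset].
  rewrite big_split/=; apply: setUSS.
    apply: (subset_trans UF); rewrite -!bigcup_mkord => x [i /= ik Fx].
    by exists i => //=; rewrite ltn_addr.
  apply: (subset_trans VG); rewrite -!bigcup_mkord => x [i /= ik Fx].
  by exists i => //=; rewrite ltn_addl.
- have [i _ Wx] := CW _ Cx.
  have [V [xV cV VW _]] := m_regular (oW i) Wx.
  pose F j := if j == i then V else set0.
  exists V => //; exists i.+1, F; split.
    by move=> j; rewrite /F; case: eqP => [->|_]; split => //; exact: closed0.
  by rewrite -(bigcup_mkord _ F) => y Vy; exists i; rewrite /F /= ?eqxx.
apply: (@le_trans _ _ (lam (\big[setU/set0]_(i < n) (C `&` F i)))).
  apply: le_lam; rewrite -big_distrr/= => x Cx; split => //; apply: VF.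
  exact: (interior_subset (CV _ Cx)).
apply: (le_trans (lam_bigU (fun i => C `&` F i) n)).
apply: (@le_trans _ _ (\sum_(i < n) rho (W i))).
  apply: lee_sum => i _; apply: rho_ge.
    by apply: compact_closedI => //; exact: (FW i).1.
  by move=> x [_ /(FW i).2].
by rewrite -(big_mkord xpredT (fun i => rho (W i))); apply: nneseries_lim_ge.
Qed.

Let nusE W : open W -> nus W = rho W.
Proof.
move=> oW; apply/eqP; rewrite eq_le; apply/andP; split.
  by apply: ereal_inf_lbound; exists W => //; split.
by apply: le_ereal_inf_tmp => _ [V [_ WV] <-]; exact: le_rho.
Qed.

Let nus_ge0 B : 0 <= nus B.
Proof. by apply: le_ereal_inf_tmp => _ [V _ <-]. Qed.

Let le_nus : {homo nus : B C / B `<=` C >-> B <= C}.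
Proof.
move=> B C BC; apply: le_ereal_inf_tmp => _ [V [oV CV] <-].
by apply: ereal_inf_lbound; exists V => //; split => //; exact: subset_trans CV.
Qed.

Let nus_fin B : nus B \is a fin_num.
Proof.
rewrite ge0_fin_numE// (le_lt_trans (le_nus (@subsetT _ B)))// nusE//; last exact: openT.
by rewrite (le_lt_trans (rho_le1 _))// ltry.
Qed.

Let nus0 : nus set0 = 0.
Proof.
rewrite nusE; last exact: open0.
apply/eqP; rewrite eq_le rho_ge0 andbT (le_trans (rho_le_m _)) ?m0//.
exact: open0.
Qed.

Let nus_adherent B (e : R) : (0 < e)%R ->
  exists W, [/\ open W, B `<=` W & rho W <= nus B + e%:E].
Proof.
move=> e0; have [_ [W [oW BW] <-] We] := lb_ereal_inf_adherent e0 (nus_fin B).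
by exists W; split => //; exact: ltW.
Qed.

Let nus_sigma_subadditive : sigma_subadditive nus.
Proof.
move=> F; apply/lee_addgt0Pr => e e0.
apply: (le_trans _ (epsilon_trick _ (fun n => nus_ge0 (F n)) (ltW e0))).
have e2 n : (0 < e / (2 ^ n.+1)%:R)%R by rewrite divr_gt0// ltr0n expn_gt0.
have [W PW] := choice (fun n => nus_adherent (F n) (e2 n)).
apply: (@le_trans _ _ (rho (\bigcup_n W n))).
  rewrite -nusE; last by apply: bigcup_open => n _; have [] := PW n.
  by apply: le_nus; apply: subset_bigcup => n _; have [] := PW n.
apply: (@le_trans _ _ (\sum_(i <oo) rho (W i))).
  by apply: rho_sigma_subadditive => n; have [] := PW n.
by apply: lee_nneseries => // n _; have [] := PW n.
Qed.

(** For open [V] around [D], take a compact [C] inside both [V] and [W], then a compact [C'] inside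
    [V] minus [C], an open set containing [V] minus [W]. These are disjoint compact subsets of [V],
    so [lamUD] bounds the sum of their contents by [rho V]; suprema over [C'] and then [C]
    finish. *)
Let open_caratheodory W : open W -> nus.-caratheodory W.
Proof.
move=> oW.
pose om : {outer_measure set T -> \bar R} := HB.pack nus
  (isOuterMeasure.Build R T nus nus0 nus_ge0 le_nus nus_sigma_subadditive).
apply: (@le_caratheodory_measurable _ _ om) => D /=.
apply: le_ereal_inf_tmp => _ [V [oV DV] <-].
apply: (@le_trans _ _ (nus (V `&` W) + nus (V `&` ~` W))).
  by rewrite leeD// le_nus//; exact: setSI.
rewrite (nusE (openI oV oW)); apply: ge_ereal_supD => //.
- by move=> _ [C _ <-].
- by exists (lam set0), set0 => //; split => //; exact: compact0.
move=> _ [C [cC CVW] <-]; have clC := compact_closed hT cC.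
have oVC : open (V `&` ~` C) by apply: openI => //; exact: closed_openC.
apply: (@le_trans _ _ (lam C + rho (V `&` ~` C))).
  rewrite leeD2l// -nusE//; apply: le_nus; apply: setIS.
  by apply: subsetC => x /CVW[].
rewrite addeC; apply: ge_ereal_supD => //.
- by move=> _ [D' _ <-].
- by exists (lam set0), set0 => //; split => //; exact: compact0.
move=> _ [C' [cC' CVC'] <-]; rewrite addeC.
apply: (le_trans (lamUD cC cC' _)).
  by rewrite setIC; apply/disjoints_subset => x /CVC'[].
apply: rho_ge; first exact: compactU.
by rewrite subUset; split=> x; [move=> /CVW[]|move=> /CVC'[]].
Qed.

Theorem radon_of_content : exists nu : {measure set (borel T) -> \bar R},
  [/\ radon nu, nu setT = 1,
      forall W : set T, open W -> nu W <= m W &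
      forall C : set T, compact C -> m C <= nu C].
Proof.
pose om : {outer_measure set T -> \bar R} := HB.pack nus
  (isOuterMeasure.Build R T nus nus0 nus_ge0 le_nus nus_sigma_subadditive).
have [nu nuE] := @caratheodory_restriction R T om (@open T) open_caratheodory.
have {}nuE B : nu B = nus B := nuE B.
have le_nu B C : B `<=` C -> nu B <= nu C by rewrite !nuE; exact: le_nus.
have nu_open W : open W -> nu W = rho W by move=> oW; rewrite nuE; exact: nusE.
have nuC C : compact C -> m C <= nu C.
  move=> cC; rewrite nuE; apply: le_ereal_inf_tmp => _ [V [_ CV] <-].
  exact: le_trans (ge_lam _) (rho_ge cC CV).
have nu1 : nu setT = 1.
  apply/eqP; rewrite eq_le nu_open ?rho_le1/=; last exact: openT.
  apply/lee_addgt0Pr => e e0; have [C cC eC] := m_tight e0.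
  by rewrite -leeBlDr// -EFinB (le_trans eC)// (le_trans (ge_lam _))// rho_ge.
have nu_fin B : nu B \is a fin_num by rewrite nuE.
exists nu; split => //; last by move=> W oW; rewrite nu_open//; exact: rho_le_m.
split=> [x|M mM].
  by exists setT; split; [exact: openT|by []|rewrite nu1 ltry].
apply/eqP; rewrite eq_le; apply/andP; split; last first.
  by apply: ge_ereal_sup => _ [C [_ CM] <-]; exact: le_nu.
apply/lee_addgt0Pr => e e0.
(* Inner regularity: [W] is an open superset of the complement of [M] with excess mass at most
   [e / 2], and [C] is compact with all but [e / 2] of the mass. Then [C] minus [W] is a compact
   subset of [M] missing at most [e] of its mass. *)
have e20 : (0 < e / 2)%R by rewrite divr_gt0.
have [W [oW MW We]] := nus_adherent (~` M) e20.
have [C cC Ce] := m_tight e20.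
have mW : measurable (W : set (borel T)) by exact: sub_sigma_algebra.
have mC : measurable (C : set (borel T)).
  rewrite -(setCK C); apply: measurableC; apply: sub_sigma_algebra.
  by apply: closed_openC; exact: compact_closed.
have MWe : nu (M `&` W) <= (e / 2)%:E.
  rewrite -(leeD2lE _ _ (nu_fin (~` M))).
  move: We; rewrite -nu_open// -nuE; apply: le_trans.
  rewrite -measureU//; [|exact: measurableC|exact: measurableI|].
    by apply: le_nu => x [/MW//|[]].
  by apply/seteqP; split=> // x [+ []].
have nCe : nu (~` C) <= (e / 2)%:E.
  have : nu C + nu (~` C) = 1.
    by rewrite -measureU ?setUv ?setICr//; exact: measurableC.
  have := le_trans Ce (nuC _ cC).
  rewrite -(fineK (nu_fin C)) -(fineK (nu_fin (~` C))) -EFinD => + [].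
  by rewrite !lee_fin; lra.
apply: (@le_trans _ _ (nu (C `&` ~` W) + (nu (M `&` W) + nu (~` C)))).
  rewrite !nuE (le_trans _ (leeD2l _ (outer_measureU2 om _ _)))//.
  rewrite (le_trans _ (outer_measureU2 om _ _))// le_nus// => x Mx.
  have [Cx|] := pselect (C x); last by right; right.
  by have [Wx|] := pselect (W x); [right; left|left].
rewrite leeD//; last by rewrite (splitr e) EFinD leeD.
apply: ereal_sup_ubound; exists (C `&` ~` W) => //; split.
  by apply: compact_closedI => //; exact: open_closedC.
by move=> x [_ nWx]; apply: contrapT => nMx; exact/nWx/MW.
Qed.

End RadonOfContent.

(** * Character spaces *)

Section CharacterTopology.
Context {R : realType} {B : charAlgType R}.
Implicit Types (chi psi : character B) (a b : B).

Lemma character_ext chi psi : (forall a, hat a chi = hat a psi) -> chi = psi.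
Proof.
case: chi psi => [f [[fD] [fM] [fZ]]] [g [[gD] [gM] [gZ]]] /= fg.
have E : f = g by exact/funext.
subst g; by rewrite (Prop_irrelevance fD gD) (Prop_irrelevance fM gM)
  (Prop_irrelevance fZ gZ).
Qed.

Lemma hatD a b chi : hat (a + b) chi = hat a chi + hat b chi.
Proof. exact: (rmorphD (chi : {lrmorphism B -> R | *%R})). Qed.

Lemma hatB a b chi : hat (a - b) chi = hat a chi - hat b chi.
Proof. exact: (rmorphB (chi : {lrmorphism B -> R | *%R})). Qed.

Lemma hatM a b chi : hat (a * b) chi = hat a chi * hat b chi.
Proof. exact: (rmorphM (chi : {lrmorphism B -> R | *%R})). Qed.

Lemma hatX a n chi : hat (a ^+ n) chi = hat a chi ^+ n.
Proof. exact: (rmorphXn (chi : {lrmorphism B -> R | *%R})). Qed.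

Lemma hat1 chi : hat 1 chi = 1.
Proof. exact: (rmorph1 (chi : {lrmorphism B -> R | *%R})). Qed.

Lemma hat0 chi : hat 0 chi = 0.
Proof. exact: (rmorph0 (chi : {lrmorphism B -> R | *%R})). Qed.

Lemma hatZ k a chi : hat (k *: a) chi = k * hat a chi.
Proof. exact: (scalarZ (chi : {lrmorphism B -> R | *%R})). Qed.

Lemma hat_alg k chi : hat (k%:A) chi = k.
Proof. by rewrite hatZ hat1 mulr1. Qed.

Lemma hat_continuous a : continuous (hat a : character B -> R).
Proof.
move=> chi.
have /cvg_sup/(_ a) h : nbhs chi --> chi by exact: cvg_id.
move=> V nV; apply: h.
exact: (@initial_continuous _ _ (hat a) chi V nV).
Qed.

Lemma cvg_character (F : set_system (character B)) chi : Filter F ->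
  (forall a, hat a @ F --> hat a chi) -> F --> chi.
Proof.
move=> FF Fchi; apply/cvg_sup => a U [_ [[V oV <-] Vchi] VU].
by apply: filterS VU _; apply: Fchi; exact: open_nbhs_nbhs.
Qed.

(** One element suffices instead of a finite family: a sum of nonnegative functions is below 1 only
    where every summand is, so these sublevel sets already form a filter base. *)
Lemma open_character_base (W : set (character B)) chi : nbhs chi W ->
  exists a, [/\ hat a chi = 0, forall psi, 0 <= hat a psi &
    forall psi, hat a psi < 1 -> W psi].
Proof.
pose D a := hat a chi = 0 /\ forall psi, 0 <= hat a psi.
pose F := filter_from [set a | D a] (fun a => [set psi | hat a psi < 1]).
have FF : Filter F.
  apply: filter_from_filter.
    by exists 0; split=> [|psi]; rewrite hat0.
  move=> a b [a0 age0] [b0 bge0]; exists (a + b).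
    by split=> [|psi]; rewrite hatD ?a0 ?b0 ?addr0// addr_ge0.
  move=> psi /=; rewrite hatD => ab1.
  by split; apply: le_lt_trans ab1; rewrite ?lerDl ?lerDr.
have Fchi : F --> chi.
  apply: cvg_character => c; apply/cvgrPdist_lt => e e0.
  (* This square is below 1 exactly where [hat c] is within [e] of its value at [chi]. *)
  exists ((e^-1 *: (c - (hat c chi)%:A)) ^+ 2).
    split=> [|psi]; rewrite hatX ?sqr_ge0//.
    by rewrite hatZ hatB hat_alg subrr mulr0 expr0n.
  move=> psi /=; rewrite hatX hatZ hatB hat_alg -real_normK ?num_real//.
  rewrite expr_lt1// normrM ger0_norm ?invr_ge0 ?ltW// mulrC ltr_pdivrMr// mul1r.
  by rewrite distrC.
by move=> /Fchi[a [a0 age0] aW]; exists a; split.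
Qed.

Lemma character_hausdorff : hausdorff_space (character B).
Proof.
move=> chi psi cp; apply: character_ext => a.
apply: (@norm_hausdorff _ R^o) => U V /hat_continuous cU /hat_continuous cV.
by have [x [Ux Vx]] := cp _ _ cU cV; exists (hat a x).
Qed.

Lemma closed_hat_le a (r : R) : closed [set chi | hat a chi <= r].
Proof.
apply: (@closed_comp _ _ (hat a) [set y : R | y <= r]).
  by move=> chi _; exact: hat_continuous.
exact: closed_le.
Qed.

Lemma open_hat_lt a (r : R) : open [set chi | hat a chi < r].
Proof.
apply: (@open_comp _ _ (hat a) [set y : R | y < r]).
  by move=> chi _; exact: hat_continuous.
exact: open_lt.
Qed.

Lemma open_hat_gt a (r : R) : open [set chi | r < hat a chi].
Proof.
apply: (@open_comp _ _ (hat a) [set y : R | r < y]).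
  by move=> chi _; exact: hat_continuous.
exact: open_gt.
Qed.

Lemma closed_nonneg_characters (P : set B) : closed (nonneg_characters P).
Proof.
have -> : nonneg_characters P = \bigcap_(a in P) ~` [set chi | hat a chi < 0].
  apply/seteqP; split=> chi h a Pa; last by rewrite leNgt; apply/negP; exact: h.
  by apply/negP; rewrite -leNgt; exact: h.
by apply: closed_bigI => a _; apply: open_closedC; exact: open_hat_lt.
Qed.

(** A character [chi] outside [K] has a neighbourhood [a < 1] missing [K] with [a] vanishing at
    [chi]. Then [a - 1] is nonnegative on [K] and equals -1 at [chi]. *)
Lemma closed_is_nonneg (K : set (character B)) : closed K ->
  K = nonneg_characters [set a | forall chi, K chi -> 0 <= hat a chi].
Proof.
move=> cK; apply/seteqP; split=> [chi Kchi a|chi Kchi]; first exact.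
apply: contrapT => nK.
have [|a [a0 _ aK]] := @open_character_base (~` K) chi.
  by apply: open_nbhs_nbhs; split => //; exact: closed_openC.
have : 0 <= hat (a - 1) chi.
  by apply: Kchi => psi Kpsi; rewrite hatB hat1 subr_ge0 leNgt; apply/negP => /aK.
by rewrite hatB a0 hat1 sub0r oppr_ge0 ler10.
Qed.

(** For a fixed character, the elements with nonnegative value form a quadratic module. *)
Lemma nonneg_characters_smallest (G : set B) :
  nonneg_characters (smallest quadratic_module G) = nonneg_characters G.
Proof.
apply/seteqP; split=> chi h a Ga; first by apply: h => Q' [_]; exact.
apply: (Ga [set a | 0 <= hat a chi]); split=> //; split => /=.
- by rewrite hat1.
- by move=> x y x0 y0; rewrite hatD addr_ge0.
- by move=> x y y0; rewrite hatM hatX mulr_ge0// sqr_ge0.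
Qed.

Lemma hat_measurable a : measurable_fun setT (hat a : borel (character B) -> R).
Proof.
apply: (measurability _ (RGenOInfty.measurableE R)).
move=> _ [_ [r ->] <-]; rewrite setTI; apply: sub_sigma_algebra.
have -> : hat a @^-1` `]r, +oo[ = [set chi | r < hat a chi].
  by apply/seteqP; split=> chi /=; rewrite in_itv/= andbT.
exact: open_hat_gt.
Qed.

End CharacterTopology.

Lemma ultra_cvg_compact (I : Type) (T : topologicalType) (U : set_system I)
    (f : I -> T) (K : set T) : UltraFilter U -> compact K ->
  (\forall i \near U, K (f i)) -> exists2 l, K l & f @ U --> l.
Proof.
move=> UU cK UK; have PU : ProperFilter U by exact: ultra_proper.
have [l [Kl fl]] := cK (f @ U) _ UK.
exists l => // V lV; have [//|nV] := in_ultra_setVsetC (f @^-1` V) UU.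
by have [x []] := fl (~` V) V nV lV.
Qed.

(** * Countably generated algebras: compact boxes and a countable base *)

Section CountablyGenerated.
Context {R : realType} {B : charAlgType R}.
Implicit Types (chi : character B).

(** Generation is phrased as an induction principle; it is applied to boundedness and to convergence
    of [hat a]. *)
Definition generating (g : nat -> B) : Prop := forall P : set B,
  P 1 -> (forall k a b, P a -> P b -> P (k *: a + b)) ->
  (forall a b, P a -> P b -> P (a * b)) -> (forall i, P (g i)) ->
  forall a, P a.

Lemma hat_linear k a b chi : hat (k *: a + b) chi = k * hat a chi + hat b chi.
Proof. by rewrite hatD hatZ. Qed.

Lemma hat_linear_fun k a b :
  hat (k *: a + b) = (fun chi : character B => k * hat a chi + hat b chi).
Proof. by apply/funext => chi; exact: hat_linear. Qed.

Lemma hat_mul_fun a b : hat (a * b) = (fun chi : character B => hat a chi * hat b chi).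
Proof. by apply/funext => chi; exact: hatM. Qed.

Lemma hat_one_fun : hat 1 = (cst 1 : character B -> R).
Proof. by apply/funext => chi; exact: hat1. Qed.

(** The algebraic identities of a character pass to pointwise limits, because limits in [R] are
    unique and respect sums and products. *)
Lemma character_limit (U : set_system (character B)) (l : B -> R) :
  ProperFilter U -> (forall a, hat a @ U --> l a) -> exists chi, U --> chi.
Proof.
move=> PU Ul.
have lE a (x : R) : hat a @ U --> x -> l a = x.
  by move=> Ux; apply: (cvg_unique _ (Ul a) Ux).
have l_lin k a b : l (k *: a + b) = k * l a + l b.
  apply: lE; rewrite hat_linear_fun.
  by apply: cvgD => //; exact: cvgMr.
have l_mul a b : l (a * b) = l a * l b.
  by apply: lE; rewrite hat_mul_fun; exact: cvgM.
have l_one : l 1 = 1.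
  by apply: lE; rewrite hat_one_fun; exact: cvg_cst.
have lD : zmod_morphism l.
  by move=> a b; rewrite addrC -scaleN1r l_lin mulN1r addrC.
have l0 : l 0 = 0 by rewrite -(subrr 0) lD subrr.
have lZ : scalable_for *%R l.
  by move=> k a; rewrite -[k *: a]addr0 l_lin l0 addr0.
have lM : monoid_morphism l by split.
pose chi : {lrmorphism B -> R | *%R} := HB.pack l
  (GRing.isZmodMorphism.Build B R l lD) (GRing.isMonoidMorphism.Build B R l lM)
  (GRing.isScalable.Build R B R *%R l lZ).
by exists (chi : character B); apply: cvg_character => a; exact: Ul.
Qed.

Variable g : nat -> B.
Hypothesis g_gen : generating g.

(** Bounds on the generators yield bounds on every element. Along an ultrafilter each [hat a]
    therefore converges, and the pointwise limit is a character. *)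
Lemma compact_box (c : nat -> R) :
  compact [set chi | forall i, `|hat (g i) chi| <= c i].
Proof.
set C := [set chi | _].
have C_bounded a : exists M : R, forall chi, C chi -> `|hat a chi| <= M.
  apply: (g_gen (P := [set a | exists M, forall chi, C chi -> `|hat a chi| <= M])).
  - by exists 1 => chi _; rewrite hat1 normr1.
  - move=> k a1 b1 [M aM] [N bN]; exists (`|k| * M + N) => chi Cchi.
    rewrite hat_linear (le_trans (ler_normD _ _))// normrM lerD ?bN//.
    by rewrite ler_wpM2l ?aM.
  - move=> a1 b1 [M aM] [N bN]; exists (M * N) => chi Cchi.
    by rewrite hatM normrM ler_pM ?aM ?bN.
  - by move=> i; exists (c i) => chi; exact.
rewrite compact_ultra => U UU UC.
have PU : ProperFilter U by exact: ultra_proper.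
have Ucvg : forall a : B, exists l : R, hat a @ U --> l.
  move=> a; have [M aM] := C_bounded a.
  have [|l _ Ul] := ultra_cvg_compact UU (@segment_compact _ (- M) M) (f := hat a).
    by apply: filterS UC => chi Cchi /=; rewrite in_itv/= -ler_norml aM.
  by exists l.
have [l Ul] := choice Ucvg.
have [chi Uchi] := character_limit PU Ul.
exists chi; split => // i.
have hU : `|hat (g i) psi| @[psi --> U] --> `|hat (g i) chi|.
  by apply: cvg_norm; exact: (cvg_comp _ _ Uchi (@hat_continuous _ _ (g i) chi)).
rewrite -(cvg_lim (@Rhausdorff R) hU); apply: limr_le; first exact: cvgP hU.
by apply: filterS UC => psi; exact.
Qed.

(** An entry holds the index of a generator, a rational centre and an [n] standing for the radius
    1/(n+1). The index type is countable and the boxes are closed, so open sets become countable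
    unions of closed sets. *)
Definition rational_box (s : seq (nat * (rat * nat))) : set (character B) :=
  [set chi | forall p, p \in s ->
     `|hat (g p.1) chi - ratr p.2.1| <= p.2.2.+1%:R^-1].

Lemma rational_box_cat s t :
  rational_box (s ++ t) = rational_box s `&` rational_box t.
Proof.
apply/seteqP; split=> [chi h|chi [hs ht] p].
  by split=> p ps; apply: h; rewrite mem_cat ps ?orbT.
by rewrite mem_cat => /orP[]; [exact: hs|exact: ht].
Qed.

Lemma rational_box_bigcap s : rational_box s = \bigcap_(p in [set` s])
  (hat (g p.1)) @^-1` [set y | `|y - ratr p.2.1| <= p.2.2.+1%:R^-1].
Proof. by apply/seteqP; split=> chi h p ps; exact: h. Qed.

(** The boxes containing [chi] form a filter base. Convergence of [hat a] along it is clear for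
    generators and propagates to all elements. *)
Lemma rational_box_base (W : set (character B)) chi : nbhs chi W ->
  exists2 s, rational_box s chi & rational_box s `<=` W.
Proof.
pose F := filter_from [set s | rational_box s chi] rational_box.
have FF : Filter F.
  apply: filter_from_filter; first by exists [::].
  by move=> s t sc tc; exists (s ++ t); rewrite /= rational_box_cat.
suff Fchi : F --> chi by move=> /Fchi[s sc sW]; exists s.
apply: cvg_character => a.
apply: (g_gen (P := [set a | hat a @ F --> hat a chi])) => /=.
- by rewrite hat_one_fun; exact: cvg_cst.
- move=> k a1 b1 aF bF; rewrite hat_linear_fun.
  by apply: cvgD => //; exact: cvgMr.
- move=> a1 b1 aF bF; rewrite hat_mul_fun; exact: cvgM.
move=> i; apply/cvgrPdist_lt => e e0.
have e20 : 0 < e / 2 by rewrite divr_gt0.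
have [n _ /(_ _ (leqnn n)) ne] := near_infty_natSinv_lt (PosNum e20).
have n0 : 0 < n.+1%:R^-1 :> R by rewrite invr_gt0 ltr0n.
have lt2 : hat (g i) chi - n.+1%:R^-1 < hat (g i) chi + n.+1%:R^-1.
  by rewrite ltrBlDr -addrA ltrDl addr_gt0.
have [q] := rat_in_itvoo lt2.
rewrite in_itv/= => /andP[q1 q2].
exists [:: (i, (q, n))].
  move=> p; rewrite inE => /eqP ->/=; apply/ltW.
  by rewrite ltr_distlC q1 q2.
move=> psi /(_ (i, (q, n)) (mem_head _ _))/= psiq.
apply: (le_lt_trans (ler_distD (ratr q) _ _)).
rewrite (splitr e); apply: ltrD.
  by rewrite (lt_trans _ ne)// ltr_distlC q1 q2.
by rewrite distrC (le_lt_trans psiq).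
Qed.

Lemma open_bigcup_rational_box (W : set (character B)) : open W ->
  exists2 F : (set (character B))^nat,
    (forall n, F n = set0 \/ exists s, F n = rational_box s) &
    W = \bigcup_n F n.
Proof.
move=> oW.
(* All boxes are enumerated by their codes; invalid codes and boxes not inside [W] contribute the
   empty set. *)
pose F n := if choice.unpickle n is Some s then
  if `[< rational_box s `<=` W >] then rational_box s else set0 else set0.
exists F.
  move=> n; rewrite /F; case: choice.unpickle => [s|]; last by left.
  by case: asboolP => _; [right; exists s|left].
apply/seteqP; split=> [chi Wchi|chi [n _]]; last first.
  rewrite /F; case: choice.unpickle => [s|//].
  by case: asboolP => // sW; exact: sW.
have [s sc sW] := rational_box_base (open_nbhs_nbhs (conj oW Wchi)).
by exists (choice.pickle s) => //; rewrite /F choice.pickleK; case: asboolP.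
Qed.

Lemma closed_rational_box s : closed (rational_box s).
Proof.
rewrite rational_box_bigcap; apply: closed_bigI => p _.
apply: closed_comp => [chi _|]; first exact: hat_continuous.
rewrite (_ : mkset _ = closed_ball_ Num.norm (ratr p.2.1) (p.2.2.+1%:R^-1 : R)).
  exact: closed_closed_ball_.
by apply/seteqP; split => y /=; rewrite distrC.
Qed.

(** Open sets are countable unions of boxes, and a box is a finite intersection of conditions on
    single generators. *)
Lemma measurable_into_characters d (X : measurableType d) (f : X -> character B) :
  (forall i, measurable_fun setT (hat (g i) \o f)) ->
  measurable_fun setT (f : X -> borel (character B)).
Proof.
move=> mf; apply: measurable_fun_g_sigma => W oW.
have [F Fbox ->] := open_bigcup_rational_box oW.
rewrite preimage_bigcup; apply: bigcup_measurable => n _.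
have [->|[s ->]] := Fbox n; first by rewrite preimage_set0.
rewrite rational_box_bigcap preimage_bigcap; apply: fin_bigcap_measurable => //.
move=> p _; rewrite -[X in measurable X]setTI -comp_preimage.
apply: mf => //.
rewrite (_ : mkset _ = closed_ball_ Num.norm (ratr p.2.1) (p.2.2.+1%:R^-1 : R)).
  by apply: closed_measurable; exact: closed_closed_ball_.
by apply/seteqP; split => y /=; rewrite distrC.
Qed.

End CountablyGenerated.

Section UnitMass.
Context d (T : measurableType d) (R : realType).
Variable mu : {measure set T -> \bar R}.
Hypothesis mu1 : mu setT = 1%E.

Lemma unit_mass_fin M : measurable M -> mu M \is a fin_num.
Proof.
move=> mM; rewrite ge0_fin_numE//; apply: (@le_lt_trans _ _ (mu setT)).
  by apply: le_measure; rewrite ?inE.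
by rewrite mu1 ltry.
Qed.

Lemma unit_mass_setC M : measurable M -> (mu M + mu (~` M) = 1)%E.
Proof. by move=> mM; rewrite -measureU ?setUv ?setICr//; exact: measurableC. Qed.

End UnitMass.

Lemma prob_tail d (T : measurableType d) (R : realType)
    (mu : {measure set T -> \bar R}) (f : T -> R) (e : R) :
  mu setT = 1%E -> measurable_fun setT f -> 0 < e ->
  exists n : nat, (mu [set x | (n%:R < `|f x|)%R] <= e%:E)%E.
Proof.
move=> mu1 mf e0; pose F n := [set x | n%:R < `|f x|].
have mF n : measurable (F n).
  rewrite (_ : F n = (fun x => `|f x|) @^-1` `]n%:R, +oo[).
    by rewrite -[X in measurable X]setTI; apply: measurableT_comp.
  by apply/seteqP; split=> x /=; rewrite in_itv/= andbT.
have F0 : \bigcap_n F n = set0.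
  rewrite -subset0 => x Fx; have := Fx (Num.bound `|f x|) I.
  by rewrite /F/= ltNge ltW// archi_boundP.
have mucvg : (mu \o F) n @[n --> \oo] --> (0%E : \bar R).
  rewrite -(measure0 mu) -F0; apply: nonincreasing_cvg_mu => //.
  - by rewrite -ge0_fin_numE// unit_mass_fin.
  - by rewrite F0.
  - move=> n k nk; apply/subsetPset => x; apply: le_lt_trans.
    by rewrite ler_nat.
apply: contrapT => nex; have : (e%:E <= 0)%E; last by rewrite lee_fin leNgt e0.
rewrite -(cvg_lim _ mucvg)//; apply: lime_ge; first exact: cvgP mucvg.
by apply: nearW => n; rewrite leNgt; apply/negP => /ltW Fn; apply: nex; exists n.
Qed.

(** * Borel measures of mass one on character spaces and the Radon property *)

Section RadonCharacters.
Context {R : realType} {B : charAlgType R}.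

(** The closed neighbourhood depends on one element only, so the Caratheodory property need only be
    known for conditions on a single [hat a]. Any threshold strictly between 0 and 1 would do. *)
Lemma character_regular (W : set (character B)) chi : open W -> W chi ->
  exists a, let V := [set psi | hat a psi <= 2^-1] in
    [/\ nbhs chi V, closed V & V `<=` W].
Proof.
move=> oW Wchi; have [a [a0 _ aW]] := open_character_base (open_nbhs_nbhs (conj oW Wchi)).
exists a; split; last 2 first.
- exact: closed_hat_le.
- move=> psi /= psia; apply: aW; apply: le_lt_trans psia _.
  by rewrite invf_lt1// ltr1n.
apply: (@filterS _ _ _ [set psi | hat a psi < 2^-1]); first by move=> psi /ltW.
apply: open_nbhs_nbhs; split; first exact: open_hat_lt.
by rewrite /= a0 invr_gt0.
Qed.

Lemma closed_borel (T : ptopologicalType) (F : set T) :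
  closed F -> measurable (F : set (borel T)).
Proof.
move=> cF; rewrite -(setCK F); apply: measurableC; apply: sub_sigma_algebra.
exact: closed_openC.
Qed.

Lemma open_borel (T : ptopologicalType) (F : set T) :
  open F -> measurable (F : set (borel T)).
Proof. exact: sub_sigma_algebra. Qed.

Lemma nonneg_characters_borel (P : set B) :
  measurable (nonneg_characters P : set (borel (character B))).
Proof. by apply: closed_borel; exact: closed_nonneg_characters. Qed.

Lemma eq_borel_measure (T : ptopologicalType)
    (mu nu : {measure set (borel T) -> \bar R}) :
  mu setT = 1%E -> (forall W, open W -> mu W = nu W) ->
  forall M, measurable M -> mu M = nu M.
Proof.
move=> mu1 munu M mM.
apply: (@measure_unique _ R (borel T) (@open T) (fun=> setT)) => //.
- exact: openI.
- by move=> _; exact: openT.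
- by apply/seteqP; split => // x _; exists 0%N.
- by move=> _; rewrite mu1 ltry.
Qed.

Lemma radon_eq (T : ptopologicalType)
    (mu nu : {measure set (borel T) -> \bar R}) :
  (forall M, measurable M -> mu M = nu M) -> hausdorff_space T ->
  radon mu -> radon nu.
Proof.
move=> munu hT [mufin mureg]; split=> [x|M mM].
  by have [U [oU Ux Uy]] := mufin x; exists U; split; rewrite -?munu//; exact: open_borel.
rewrite -munu// mureg//; congr ereal_sup; apply/seteqP; split=> _ [C [cC CM] <-].
  by exists C => //; rewrite munu//; apply: closed_borel; exact: compact_closed.
by exists C => //; rewrite munu//; apply: closed_borel; exact: compact_closed.
Qed.

Variable g : nat -> B.
Hypothesis g_gen : generating g.

(* The measure built from the content [mu_ext mu] agrees with [mu] on open sets,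
   since these are countable unions of closed boxes. *)
Theorem radon_character (mu : {measure set (borel (character B)) -> \bar R}) :
  mu setT = 1%E -> radon mu.
Proof.
move=> mu1; set T := character B in mu mu1 *.
have muE M : measurable M -> mu_ext mu M = mu M by exact: measurable_mu_extE.
have hT : hausdorff_space T by exact: character_hausdorff.
have tight (e : R) : 0 < e -> exists2 C : set T, compact C & ((1 - e)%:E <= mu_ext mu C)%E.
  move=> e0.
  have e2 n : 0 < e / (2 ^ n.+1)%:R by rewrite divr_gt0// ltr0n expn_gt0.
  have [c Pc] := choice (fun i => prob_tail mu1 (@hat_measurable _ _ (g i)) (e2 i)).
  (* The i-th tail has mass at most [e / 2 ^ i.+1], so the complement of this compact box has mass
     at most [e]. *)
  set C := [set chi | forall i, `|hat (g i) chi| <= (c i)%:R].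
  have cC : compact C by exact: compact_box.
  have mC : measurable (C : set (borel T)).
    by apply: closed_borel; exact: compact_closed.
  exists C => //; rewrite muE//.
  have nCe : (mu (~` C) <= e%:E)%E.
    apply: le_trans (epsilon_trick0 xpredT (ltW e0)).
    have mtail i : measurable ([set chi | (c i)%:R < `|hat (g i) chi|] : set (borel T)).
      rewrite (_ : mkset _ = (fun x => `|hat (g i) x|) @^-1` `](c i)%:R, +oo[).
        rewrite -[X in measurable X]setTI; apply: measurableT_comp => //.
        exact: hat_measurable.
      by apply/seteqP; split=> x /=; rewrite in_itv/= andbT.
    apply: (@le_trans _ _ (mu (\bigcup_i [set chi | (c i)%:R < `|hat (g i) chi|]))).
      apply: le_measure; rewrite ?inE; [exact: measurableC|exact: bigcup_measurable|].
      move=> chi; apply: contra_notP => nchi i.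
      by rewrite leNgt; apply/negP => ci; apply: nchi; exists i.
    apply: (@le_trans _ _ (\sum_(i <oo) mu [set chi | ((c i)%:R < `|hat (g i) chi|)%R])%E).
      by apply: measure_sigma_subadditive => //; exact: bigcup_measurable.
    exact: lee_nneseries.
  have mu1' := unit_mass_setC mu1 mC.
  rewrite EFinB leeBlDr// -mu1' leeD2l//.
have [||||||nu [radnu nu1 nuW nuC]] := @radon_of_content R T (mu_ext mu) hT.
- exact: outer_measure0.
- by move=> C D CD; exact: (@le_mu_ext _ (borel T) R mu C D CD).
- by move=> C D; exact: (@outer_measureU2 (borel T) R (mu_ext mu) C D).
- by rewrite muE// mu1.
- move=> W chi oW Wchi; have [a /= [xV cV VW]] := character_regular oW Wchi.
  exists [set psi | hat a psi <= 2^-1]; split => //.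
  exact: (sub_caratheodory mu (sub_gen_smallest (closed_borel cV))).
- exact: tight.
have nuW' W : open W -> (nu W <= mu W)%E.
  by move=> oW; rewrite -(muE W) ?nuW//; exact: open_borel.
(* Both measures have mass one, so the inequality on open sets reverses on their complements. *)
have nuF F : closed F -> (mu F <= nu F)%E.
  move=> cF; have mF := closed_borel cF.
  have mCF := measurableC mF.
  have := nuW' _ (closed_openC cF).
  have := unit_mass_setC nu1 mF; have := unit_mass_setC mu1 mF.
  rewrite -(fineK (unit_mass_fin nu1 mF)) -(fineK (unit_mass_fin mu1 mF)).
  rewrite -(fineK (unit_mass_fin nu1 mCF)) -(fineK (unit_mass_fin mu1 mCF)).
  by rewrite -!EFinD !lee_fin => -[h1] [h2]; lra.
apply: (radon_eq _ hT radnu); apply: eq_borel_measure => // W oW.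
apply/eqP; rewrite eq_le nuW'//=.
have [F Fbox WE] := open_bigcup_rational_box g_gen oW.
have cF n : closed (F n).
  by have [->|[s ->]] := Fbox n; [exact: closed0|exact: closed_rational_box].
(* Finite unions of closed boxes increase to [W], which carries the inequality from closed sets to
   the open set [W]. *)
pose G n := \big[setU/set0]_(i < n.+1) F i.
have cG n : closed (G n) by apply: closed_bigsetU => i _; exact: cF.
have GE : \bigcup_n G n = W by rewrite bigcup_bigsetU_bigcup.
have mucvg : (mu \o G) n @[n --> \oo] --> mu W.
  rewrite -GE; apply: nondecreasing_cvg_mu.
  - by move=> n; exact: closed_borel.
  - by rewrite GE; exact: open_borel.
  - by move=> n k nk; exact/subsetPset/subset_bigsetU.
rewrite -(cvg_lim _ mucvg)//; apply: lime_le; first exact: cvgP mucvg.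
apply: nearW => n; apply: (le_trans (nuF _ (cG n))).
apply: le_measure; rewrite ?inE; [exact: closed_borel|exact: open_borel|].
by rewrite -GE; exact: bigcup_sup.
Qed.

End RadonCharacters.

(** * Subalgebras and restriction maps *)

Lemma continuous_borel (T U : ptopologicalType) (f : T -> U) : continuous f ->
  measurable_fun setT (f : borel T -> borel U).
Proof.
move=> /continuousP cf; apply: measurable_fun_g_sigma => W oW.
by apply: open_borel; exact: cf.
Qed.

Section SubalgebraGeneration.
Context {R : realType} {A : charAlgType R}.
Implicit Types (G : set A) (S T : subalgClosed A).

Lemma subalg_closed_setP (D : set A) : GRing.subalg_closed [pred x | x \in D] <->
  [/\ D 1, forall k a b, D a -> D b -> D (k *: a + b)
         & forall a b, D a -> D b -> D (a * b)].
Proof.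
split=> -[D1 DZ DM]; split.
- by move: D1; rewrite !inE.
- by move=> k a b; have := DZ k a b; rewrite !inE.
- by move=> a b; have := DM a b; rewrite !inE.
- by rewrite !inE.
- by move=> k a b; rewrite !inE; exact: DZ.
- by move=> a b; rewrite !inE; exact: DM.
Qed.

Definition subalg_generated_pred G : {pred A} := [pred x | x \in subalg_generated G].

Lemma subalg_generated_closed G :
  GRing.subalg_closed (subalg_generated_pred G).
Proof.
apply/subalg_closed_setP; split=> [D|k a b Ga Gb D|a b Ga Gb D] [cD GD].
- by have /subalg_closed_setP[] := cD.
- have /subalg_closed_setP[_ DZ _] := cD.
  by apply: DZ; [exact: Ga|exact: Gb].
- have /subalg_closed_setP[_ _ DM] := cD.
  by apply: DM; [exact: Ga|exact: Gb].
Qed.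

HB.instance Definition _ G := GRing.isSubalgClosed.Build R A
  (subalg_generated_pred G) (subalg_generated_closed G).

Definition gen G : subalgClosed A := subalg_generated_pred G.

Lemma genE G : [set` gen G] = subalg_generated G.
Proof. by apply/seteqP; split=> a; rewrite /= inE. Qed.

Lemma gen_mem G a : G a -> a \in gen G.
Proof. by move=> Ga; rewrite inE => D [_]; exact. Qed.

Lemma subalg_generated_min G S : G `<=` [set` S] -> subalg_generated G `<=` [set` S].
Proof.
move=> GS; apply: smallest_sub => //.
have [S1 SZ SM] := subalgClosedP S.
by apply/subalg_closed_setP; split=> //= k a b; exact: SZ.
Qed.

Lemma gen_min G S : G `<=` [set` S] -> {subset gen G <= S}.
Proof.
move=> /subalg_generated_min GS a aG; apply: GS.
by rewrite -genE.
Qed.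

Lemma fin_gen_gen G : finite_set G -> fin_gen (gen G).
Proof. by move=> fG; exists G => //; rewrite genE. Qed.

Lemma fin_gen_count S : fin_gen S -> count_gen S.
Proof. by move=> [G fG SG]; exists G => //; exact: finite_set_countable. Qed.

Lemma count_gen_upper (F : nat -> subalgClosed A) : (forall n, count_gen (F n)) ->
  exists T, count_gen T /\ forall n, {subset F n <= T}.
Proof.
move=> cF.
have Gex n : exists G, countable G /\ [set` F n] = subalg_generated G.
  by have [G cG FG] := cF n; exists G.
have [G PG] := choice Gex.
exists (gen (\bigcup_n G n)); split.
  exists (\bigcup_n G n); last by rewrite genE.
  by apply: bigcup_countable => // n _; exact: (PG n).1.
move=> n a Fa; have : [set` F n] a by [].
rewrite (PG n).2; apply: subalg_generated_min => b Gb.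
by apply: gen_mem; exists n.
Qed.

Lemma count_gen_upper2 S T : count_gen S -> count_gen T ->
  exists T', [/\ count_gen T', {subset S <= T'} & {subset T <= T'}].
Proof.
move=> cS cT; pose F n := if n is 0%N then S else T.
have [|T' [cT' FT']] := count_gen_upper (F := F); first by case.
by exists T'; split => //; [exact: (FT' 0%N)|exact: (FT' 1%N)].
Qed.

Lemma count_gen_generating S : count_gen S ->
  exists g : nat -> subalg S, generating g.
Proof.
move=> [G cG SG].
have GS : G `<=` [set` S] by rewrite SG; exact: sub_gen_smallest.
have [e Ge] : exists e : nat -> subalg S, forall a, G a -> exists n, val (e n) = a.
  have [G0|[f]] := pfcard_geP cG.
    by exists (fun=> 1) => // a; rewrite G0.
  pose e n : subalg S := insubd (1 : subalg S) (f n).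
  exists e => // a Ga; have [n _ fn] : (f @` setT) a by apply: surj.
  by exists n; rewrite /e val_insubd fn; have /= -> := GS _ Ga.
exists e => P P1 PZ PM Pe.
(* The predicate on [subalg S] is moved to a subset of [A], where minimality of the generated
   subalgebra can be used. *)
have SP : [set` S] `<=` [set a | exists h : a \in S, P (Sub a h)].
  rewrite SG; apply: smallest_sub => /=.
    have [S1 SZ SM] := subalgClosedP S.
    apply/subalg_closed_setP; split=> [|k a b|a b].
    - by exists S1; rewrite (_ : Sub 1 S1 = 1)//; exact: val_inj.
    - move=> [ha Pa] [hb Pb]; exists (SZ k _ _ ha hb).
      by have := PZ k _ _ Pa Pb; congr P; exact: val_inj.
    - move=> [ha Pa] [hb Pb]; exists (SM _ _ ha hb).
      by have := PM _ _ Pa Pb; congr P; exact: val_inj.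
  move=> a /[dup] /GS /= aS /Ge[n en]; exists aS.
  by rewrite (_ : Sub a aS = e n)//; apply: val_inj; rewrite en SubK.
move=> a; have [h] := SP (val (a : subalg S)) (valP (a : subalg S)).
by congr P; apply: val_inj; rewrite SubK.
Qed.

End SubalgebraGeneration.

Section Restriction.
Context {R : realType} {A : charAlgType R}.
Implicit Types (S T : subalgClosed A).

Lemma hat_res S (a : subalg S) chi : hat a (res S chi) = hat (emb S a) chi.
Proof. by []. Qed.

Lemma res_sub_res S T (sST : {subset S <= T}) chi :
  res_sub sST (res T chi) = res S chi.
Proof. by apply: character_ext => a. Qed.

Lemma characters_continuous (B : charAlgType R) (X : topologicalType)
    (f : X -> character B) :
  (forall a, continuous (hat a \o f)) -> continuous f.
Proof. by move=> cf x; apply: cvg_character => a; exact: cf. Qed.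

Lemma res_continuous S : continuous (res S).
Proof. by apply: characters_continuous => a; exact: hat_continuous. Qed.

Lemma res_sub_continuous S T (sST : {subset S <= T}) : continuous (res_sub sST).
Proof. by apply: characters_continuous => a; exact: hat_continuous. Qed.

Lemma res_measurable S :
  measurable_fun setT (res S : borel (character A) -> borel (character (subalg S))).
Proof. by apply: continuous_borel; exact: res_continuous. Qed.

Lemma res_sub_measurable S T (sST : {subset S <= T}) : measurable_fun setT
  (res_sub sST : borel (character (subalg T)) -> borel (character (subalg S))).
Proof. by apply: continuous_borel; exact: res_sub_continuous. Qed.

(** Each generator [a] is already seen by the finitely generated subalgebra [gen [set a]], so
    conditions on it are cylinders; countably many generators then give all Borel sets. *)
Lemma res_measurable_cylinder S : count_gen S -> measurable_fun setT
  (res S : g_sigma_algebraType (cylinder A) -> borel (character (subalg S))).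
Proof.
move=> /count_gen_generating[g g_gen]; apply: (measurable_into_characters g_gen) => i.
move=> _ M mM; rewrite setTI; apply: sub_sigma_algebra.
pose a := emb S (g i).
have aG : a \in gen [set a] by apply: gen_mem.
exists (gen [set a]); first exact/fin_gen_gen/finite_set1.
pose a' : subalg (gen [set a]) := Sub a aG.
exists (hat a' @^-1` M).
  by rewrite -[X in measurable X]setTI; exact: hat_measurable.
apply/seteqP; split=> chi /=; rewrite /hat /res/= /a' /emb; by rewrite SubK.
Qed.

End Restriction.

(** * Representing measures on the cylinder sigma-algebra *)

Section Transfer.
Context {R : realType} {B : charAlgType R} {d} {X : measurableType d}.
Variables (f : X -> character B).
Hypothesis mf : measurable_fun setT (f : X -> borel (character B)).
Variables (mu : {measure set X -> \bar R}).
Variables (nu : {measure set (borel (character B)) -> \bar R}).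
Hypothesis munu : forall M, measurable M -> nu M = mu (f @^-1` M).
Local Open Scope ereal_scope.

Let mhat (a : B) : measurable_fun setT (fun x : borel (character B) => (hat a x)%:E).
Proof. by apply/measurable_EFinP; exact: hat_measurable. Qed.

Let mhatf (a : B) : measurable_fun setT (fun x => (hat a (f x))%:E).
Proof. by apply/measurable_EFinP; apply: measurableT_comp mf; exact: hat_measurable. Qed.

Lemma transfer_integrable (a : B) :
  nu.-integrable setT (fun chi : borel (character B) => (hat a chi)%:E) <->
  mu.-integrable setT (fun x => (hat a (f x))%:E).
Proof.
have E : \int[nu]_x `|(hat a x)%:E| = \int[mu]_x `|(hat a (f x))%:E|.
  transitivity (\int[pushforward mu (f : X -> borel (character B))]_x `|(hat a x)%:E|).
    by unshelve apply: eq_measure_integral => // M mM _; exact: munu.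
  rewrite ge0_integral_pushforward//.
  by apply: measurableT_comp => //; exact: mhat.
by split=> /integrableP[_ h]; apply/integrableP; split => //; rewrite ?E// -E.
Qed.

Lemma transfer_integral (a : B) :
  mu.-integrable setT (fun x => (hat a (f x))%:E) ->
  \int[nu]_x (hat a x)%:E = \int[mu]_x (hat a (f x))%:E.
Proof.
move=> ia; transitivity
    (\int[pushforward mu (f : X -> borel (character B))]_x (hat a x)%:E).
  by unshelve apply: eq_measure_integral => // M mM _; exact: munu.
by rewrite (integral_pushforward mf (mhat a))// preimage_setT.
Qed.

End Transfer.

Lemma pushforward_exists (R : realType) d d' (X : measurableType d)
    (Y : measurableType d') (mu : {measure set X -> \bar R}) (f : X -> Y) :
  measurable_fun setT f ->
  exists nu : {measure set Y -> \bar R}, forall M, nu M = mu (f @^-1` M).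
Proof. by move=> mf; unshelve eexists (pushforward mu f). Qed.

Section Representing.
Context {R : realType} {B : charAlgType R} {G : set (set (character B))}.

Lemma representing_mass (ell : B -> R) K
    (nu : {measure set (g_sigma_algebraType G) -> \bar R}) :
  representing ell K nu -> ell 1 = 1 -> nu setT = 1%E.
Proof.
move=> [_ _ /(_ 1)[_]] + ell1; rewrite ell1 => ->.
under eq_integral do rewrite hat1.
by rewrite integral_cst// mul1e.
Qed.

End Representing.

Section PartOne.
Context {R : realType} {A : charAlgType R} (L : {scalar A}).
Hypothesis L1 : L 1 = 1.
Implicit Types (S T : subalgClosed A) (Q : set A).

Lemma representing_res Q (mu : {measure set (g_sigma_algebraType (cylinder A)) -> \bar R}) S
    (nu : {measure set (borel (character (subalg S))) -> \bar R}) :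
  count_gen S ->
  (forall M, measurable M -> nu M = mu (res S @^-1` M)) ->
  representing L (res S @^-1` nonneg_characters (inter_subalg Q S)) mu ->
  representing (L \o emb S) (nonneg_characters (inter_subalg Q S)) nu.
Proof.
move=> cS nuE [_ mu0 muL].
have mK := nonneg_characters_borel (inter_subalg Q S).
split=> //; first by rewrite nuE//; exact: measurableC.
move=> a; have [ia La] := muL (emb S a).
split; first exact/(transfer_integrable (res_measurable_cylinder cS) nuE).
by rewrite La -(transfer_integral (res_measurable_cylinder cS) nuE).
Qed.

Lemma cylinder_to_systems Q
    (mu : {measure set (g_sigma_algebraType (cylinder A)) -> \bar R}) :
  representing L setT mu ->
  (forall S, fin_gen S ->
    representing L (res S @^-1` nonneg_characters (inter_subalg Q S)) mu) ->
  exists muI : measure_family A,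
    [/\ forall S, fin_gen S ->
          representing (L \o emb S)
            (nonneg_characters (inter_subalg Q S)) (muI S) /\ radon (muI S),
        exact_system fin_gen muI &
        exists2 muL : measure_family A, corresponding_system muI muL & thick muL].
Proof.
move=> muL muQ; have mu1 := representing_mass muL L1.
(* A family is indexed by all subalgebras; the zero measure fills the indices that are not countably
   generated. The same family then serves as both systems. *)
have ex S : exists nu : {measure set (borel (character (subalg S))) -> \bar R},
    count_gen S -> forall M, nu M = mu (res S @^-1` M).
  have [cS|nS] := pselect (count_gen S); last by exists mzero.
  have [nu nuE] := pushforward_exists mu (res_measurable_cylinder cS).
  by exists nu => _ M; rewrite nuE.
pose nu : measure_family A := fun S => projT1 (cid (ex S)).
have nuE S : count_gen S -> forall M, nu S M = mu (res S @^-1` M).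
  exact: projT2 (cid (ex S)).
have nu1 S : count_gen S -> nu S setT = 1%E by move=> cS; rewrite nuE.
have nu_radon S : count_gen S -> radon (nu S).
  move=> cS; have [g g_gen] := count_gen_generating cS.
  exact: (radon_character g_gen (nu1 S cS)).
have nu_exact S T (sST : {subset S <= T}) : count_gen S -> count_gen T ->
    forall M, nu T (res_sub sST @^-1` M) = nu S M.
  move=> cS cT M; rewrite (nuE _ cT) (nuE _ cS) -comp_preimage; congr (mu (_ @^-1` M)).
  by apply/funext => chi; exact: res_sub_res.
exists nu; split.
- move=> S fS; have cS := fin_gen_count fS; split; last exact: nu_radon.
  by apply: representing_res (muQ S fS) => // M mM; exact: nuE.
- move=> S T sST fS fT M mM; apply: nu_exact; exact: fin_gen_count.
exists nu.
  split=> [S T sST cS cT M mM|T cT]; first exact: nu_exact.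
  split; [exact: nu_radon|exact: nu1|move=> S sST fS M mM].
  by apply: nu_exact => //; exact: fin_gen_count.
(* Thickness: a set missing the range of [res T] has empty preimage. *)
move=> T cT M mM TM; rewrite nuE// -(measure0 mu); congr (mu _).
rewrite -subset0 => chi Mchi.
have : (range (res T) `&` M) (res T chi) by split => //; exists chi.
by rewrite TM.
Qed.

(** * Assembling a cylinder measure from a thick system *)

Section SystemsToCylinder.
Variables muI muL : measure_family A.
Hypothesis mu_corr : corresponding_system muI muL.
Hypothesis mu_thick : thick muL.
Local Open Scope ereal_scope.

Let outer T : set (character A) -> \bar R := 
  image_outer (res T : character A -> borel (character (subalg T))) (muL T).

(** A measurable superset in X(S) pulls back to one in X(T) of the same measure by exactness, so
    enlarging the subalgebra can only lower the outer measure. *)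
Let outer_anti S T (sST : {subset S <= T}) B : count_gen S -> count_gen T ->
  outer T B <= outer S B.
Proof.
move=> cS cT; apply: image_outer_ge => M mM BM.
have [ex _] := mu_corr; rewrite -(ex _ _ sST cS cT M mM).
apply: image_outer_le.
  by rewrite -[X in measurable X]setTI; exact: res_sub_measurable.
by move=> chi /BM /=; rewrite res_sub_res.
Qed.

(* The outer measures [outer T] decrease along [count_gen]; countable directedness
   of [count_gen] makes their infimum sigma-subadditive. *)
Definition cylinder_outer (B : set (character A)) : \bar R :=
  ereal_inf [set outer T B | T in count_gen].

Let cyl_le T B : count_gen T -> cylinder_outer B <= outer T B.
Proof. by move=> cT; apply: ereal_inf_lbound; exists T. Qed.

Let cyl_ge0 B : 0 <= cylinder_outer B.
Proof. by apply: le_ereal_inf_tmp => _ [T _ <-]; exact: image_outer_ge0. Qed.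

Let cyl_mono : {homo cylinder_outer : B C / B `<=` C >-> B <= C}.
Proof.
move=> B C BC; apply: le_ereal_inf_tmp => _ [T cT <-].
by apply: (le_trans (cyl_le _ cT)); exact: le_image_outer.
Qed.

Let count_gen0 : count_gen (gen (set0 : set A)).
Proof. by apply: fin_gen_count; apply: fin_gen_gen. Qed.

Let cyl0 : cylinder_outer set0 = 0.
Proof.
apply/eqP; rewrite eq_le cyl_ge0 andbT (le_trans (cyl_le _ count_gen0))//.
by rewrite /outer image_outer0.
Qed.

Let cyl_fin B : cylinder_outer B \is a fin_num.
Proof.
rewrite ge0_fin_numE// (le_lt_trans (cyl_le _ count_gen0))//.
have [_ /(_ _ count_gen0)[_ nu1 _]] := mu_corr.
rewrite (@le_lt_trans _ _ (muL (gen set0) setT))//; first exact: image_outer_le.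
by rewrite nu1 ltry.
Qed.

Let cyl_sigma_subadditive : sigma_subadditive cylinder_outer.
Proof.
move=> F; apply/lee_addgt0Pr => e e0.
apply: (le_trans _ (epsilon_trick _ (fun n => cyl_ge0 (F n)) (ltW e0))).
have e2 n : (0 < e / (2 ^ n.+1)%:R)%R by rewrite divr_gt0// ltr0n expn_gt0.
have near_inf n : exists T, count_gen T /\
    outer T (F n) <= cylinder_outer (F n) + (e / (2 ^ n.+1)%:R)%:E.
  have [_ [T cT <-] Te] := lb_ereal_inf_adherent (e2 n) (cyl_fin (F n)).
  by exists T; split => //; exact: ltW.
have [T PT] := choice near_inf.
have [T' [cT' TT']] := count_gen_upper (fun n => (PT n).1).
apply: (le_trans (cyl_le _ cT')).
apply: (le_trans (image_outer_sigma_subadditive _ _ _)).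
apply: lee_nneseries => [n _ _|n _]; first exact: image_outer_ge0.
by apply: le_trans (PT n).2; apply: outer_anti => //; exact: (PT n).1.
Qed.

(** Any [T] can be enlarged to a [T'] containing [S] without increasing the outer measure. There the
    cylinder is a preimage under [res T'], along which [outer T'] splits exactly. *)
Let cylinder_caratheodory C : cylinder A C -> cylinder_outer.-caratheodory C.
Proof.
move=> [S fS [M mM ->]]; have cS := fin_gen_count fS.
pose om : {outer_measure set character A -> \bar R} := HB.pack cylinder_outer
  (isOuterMeasure.Build R _ cylinder_outer cyl0 cyl_ge0 cyl_mono cyl_sigma_subadditive).
apply: (@le_caratheodory_measurable _ _ om) => D /=.
apply: le_ereal_inf_tmp => _ [T cT <-].
have [T' [cT' ST' TT']] := count_gen_upper2 cS cT.
apply: le_trans (outer_anti TT' D cT cT').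
have -> : res S @^-1` M = res T' @^-1` (res_sub ST' @^-1` M).
  by apply/seteqP; split=> chi; rewrite /= res_sub_res.
rewrite /outer [leRHS](@image_outer_caratheodory _ _ _ _
  (res T' : character A -> borel _) (muL T') (res_sub ST' @^-1` M)); last first.
  by rewrite -[X in measurable X]setTI; exact: res_sub_measurable.
by rewrite leeD// cyl_le.
Qed.

Let cyl_val S : fin_gen S ->
  forall M : set (borel (character (subalg S))), measurable M ->
  cylinder_outer (res S @^-1` M) = muI S M.
Proof.
move=> fS M mM; have cS := fin_gen_count fS.
have [ex fI] := mu_corr.
apply/eqP; rewrite eq_le; apply/andP; split.
  apply: (le_trans (cyl_le _ cS)).
  have [_ _ /(_ S (fun _ => id) fS M mM) <-] := fI S cS.
  apply: image_outer_le.
    by rewrite -[X in measurable X]setTI; exact: res_sub_measurable.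
  by move=> chi /=; rewrite res_sub_res.
apply: le_ereal_inf_tmp => _ [T cT <-].
have [T' [cT' ST' TT']] := count_gen_upper2 cS cT.
apply: le_trans (outer_anti TT' _ cT cT').
apply: image_outer_ge => N mN MN.
have [_ _ /(_ S ST' fS M mM) <-] := fI T' cT'; rewrite /pushforward.
have mM' : measurable (res_sub ST' @^-1` M : set (borel (character (subalg T')))).
  by rewrite -[X in measurable X]setTI; exact: res_sub_measurable.
have mD := measurableD mM' mN.
(* [N] contains every character in the preimage of [M] that extends to [A], so the remaining
   difference misses the range of [res T'] and is null by thickness. *)
apply: (@le_trans _ _ (muL T' (N `|` (res_sub ST' @^-1` M `\` N)))).
  apply: le_measure; rewrite ?inE//; first exact: measurableU.
  by move=> chi Mchi; have [Nchi|nN] := pselect (N chi); [left|right].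
apply: (le_trans (measureU2 _ mN mD)).
rewrite [X in _ + X](mu_thick cT' mD) ?adde0//.
rewrite -subset0 => _ [[chi _ <-] [Mchi nN]]; apply: nN; apply: MN.
by move: Mchi; rewrite /= res_sub_res.
Qed.

Lemma systems_to_cylinder Q :
  (forall S, fin_gen S -> representing (L \o emb S)
    (nonneg_characters (inter_subalg Q S)) (muI S)) ->
  exists mu : {measure set (g_sigma_algebraType (cylinder A)) -> \bar R},
    representing L setT mu /\
    forall S, fin_gen S ->
      representing L (res S @^-1` nonneg_characters (inter_subalg Q S)) mu.
Proof.
move=> muI_rep.
pose om : {outer_measure set character A -> \bar R} := HB.pack cylinder_outer
  (isOuterMeasure.Build R _ cylinder_outer cyl0 cyl_ge0 cyl_mono cyl_sigma_subadditive).
have [mu muE] := @caratheodory_restriction R (character A) om (cylinder A)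
  cylinder_caratheodory.
have mu_val S (fS : fin_gen S) (M : set (borel (character (subalg S)))) :
    measurable M -> muI S M = mu (res S @^-1` M).
  by move=> mM; rewrite muE -(cyl_val fS).
have mu_int (a : A) :
    mu.-integrable setT
      (fun chi : g_sigma_algebraType (cylinder A) => (hat a chi)%:E) /\
    (L a)%:E = \int[mu]_chi (hat a chi)%:E.
  have fS : fin_gen (gen [set a]) by apply: fin_gen_gen; exact: finite_set1.
  have aS : a \in gen [set a] by exact: gen_mem.
  pose a' : subalg (gen [set a]) := Sub a aS.
  have a'E chi : hat a' (res (gen [set a]) chi) = hat a chi.
    by rewrite hat_res /emb SubK.
  have [_ _ /(_ a')[ia La]] := muI_rep _ fS.
  have mres := res_measurable_cylinder (fin_gen_count fS).
  have ia' := (transfer_integrable mres (mu_val _ fS) a').1 ia.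
  have := transfer_integral mres (mu_val _ fS) ia'.
  rewrite -La /= /emb SubK => ->.
  by split; [move: ia'|]; rewrite /= ?(funext a'E)//; under eq_integral do rewrite a'E.
exists mu; split=> [|S fS].
  by split => //; rewrite setCT measure0.
have mK := nonneg_characters_borel (inter_subalg Q S).
split=> //.
  apply: sub_sigma_algebra; exists S => //.
  by exists (nonneg_characters (inter_subalg Q S)).
have [_ mu0 _] := muI_rep _ fS.
by rewrite preimage_setC -mu_val//; exact: measurableC.
Qed.

End SystemsToCylinder.

(** The complement of the support is the union of the sets where some generator is negative. There
    are countably many, and each is null by the support condition for the subalgebra generated by
    that one element. *)
Lemma cylinder_support_count_gen Q
    (mu : {measure set (g_sigma_algebraType (cylinder A)) -> \bar R}) :
  count_gen_qm Q -> representing L setT mu ->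
  (forall S, fin_gen S ->
    representing L (res S @^-1` nonneg_characters (inter_subalg Q S)) mu) ->
  representing L (nonneg_characters Q) mu.
Proof.
move=> [G cG QG] muL muQ; have [_ _ mu_int] := muL.
rewrite QG nonneg_characters_smallest.
have GQ : G `<=` Q by rewrite QG; exact: sub_gen_smallest.
have [G0|[e]] := pfcard_geP cG.
  rewrite G0 (_ : nonneg_characters set0 = setT)//.
  by apply/seteqP; split=> // chi _ a [].
pose N n : set (g_sigma_algebraType (cylinder A)) := [set chi | hat (e n) chi < 0].
have NE : ~` nonneg_characters G = \bigcup_n N n.
  apply/seteqP; split=> [chi|chi [n _ Nchi] Gchi].
    apply: contra_notP => nN a Ga; rewrite leNgt; apply/negP => a0.
    have [n _ en] : (e @` setT) a by apply: surj.
    by apply: nN; exists n => //; rewrite /N /= en.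
  have := Gchi (e n) _; rewrite leNgt Nchi => /(_ _)/negP; apply => //.
  by apply: funS.
have null n : measurable (N n) /\ mu (N n) = 0%E.
  have Gen : G (e n) by apply: funS.
  have fS : fin_gen (gen [set e n]) by apply: fin_gen_gen; exact: finite_set1.
  have aS : e n \in gen [set e n] by exact: gen_mem.
  pose a : subalg (gen [set e n]) := Sub (e n) aS.
  have aE chi : hat a (res _ chi) = hat (e n) chi by rewrite hat_res /emb SubK.
  have mN : measurable (N n).
    apply: sub_sigma_algebra; exists (gen [set e n]) => //.
    exists [set chi | hat a chi < 0]; first by apply: open_borel; exact: open_hat_lt.
    by apply/seteqP; split=> chi; rewrite /preimage /N /mkset aE.
  split=> //; have [mK muK _] := muQ _ fS.
  apply/eqP; rewrite -measure_le0 -muK; apply: le_measure; rewrite ?inE//.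
    exact: measurableC.
  move=> chi Nchi /(_ a); rewrite aE leNgt Nchi => /(_ _)/negP; apply => //.
  by rewrite /inter_subalg /mkset /emb SubK; exact: GQ.
have mU : measurable (\bigcup_n N n) by apply: bigcup_measurable => n _; exact: (null n).1.
split=> //.
  by rewrite -(setCK (nonneg_characters G)) NE; exact: measurableC.
rewrite NE; apply/eqP; rewrite -measure_le0.
apply: (@le_trans _ _ (\sum_(n <oo) mu (N n))%E).
  by apply: measure_sigma_subadditive => // n; exact: (null n).1.
by rewrite eseries0// => n _ _; exact: (null n).2.
Qed.

End PartOne.

(** * Representing Radon measures *)

Section LayerCake.
Context {R : realType}.

(** For positive [y] up to [n] this is the ceiling of [y] minus one, hence within one of [y]. The
    strict inequality makes the layers of a continuous function open. *)
Definition tail_count (n : nat) (y : R) : R :=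
  \sum_(0 <= k < n) (if k.+1%:R < y then 1 else 0).

Lemma tail_count_le n y : 0 <= y -> tail_count n y <= y.
Proof.
(* The bound by [n] feeds the induction: a new layer is counted only when [y] exceeds [n.+1]. *)
move=> y0; suff: tail_count n y <= y /\ tail_count n y <= n%:R by case.
elim: n => [|n [IHy IHn]]; first by rewrite /tail_count big_geq.
rewrite /tail_count big_nat_recr//= -/(tail_count n y).
case: ltP => ny; last by rewrite addr0; split=> //; rewrite (le_trans IHn)// ler_nat.
by split; [rewrite (le_trans _ (ltW ny))// -natr1 lerD2r|rewrite -natr1 lerD2r].
Qed.

Lemma le_tail_count n y : y <= n%:R -> y <= 1 + tail_count n y.
Proof.
move=> yn.
have [nE|//] : tail_count n y = n%:R \/ y <= 1 + tail_count n y.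
  elim: (n) => [|k IH]; first by rewrite /tail_count big_geq//; left.
  rewrite /tail_count big_nat_recr//= -/(tail_count k y).
  case: IH => [kE|yk]; last first.
    by right; rewrite (le_trans yk)// lerD2l lerDl; case: ifP.
  rewrite kE; case: ltP => yk; [by left; rewrite natr1|right].
  by rewrite addr0 addrC natr1.
by rewrite nE (le_trans yn)// lerDr.
Qed.

Context d (X : measurableType d) (mu : {measure set X -> \bar R}) (f : X -> R).
Hypothesis mf : measurable_fun setT f.
Hypothesis f0 : forall x, 0 <= f x.
Local Open Scope ereal_scope.

Let tail k := [set x | (k.+1%:R < f x)%R].

Let mtail k : measurable (tail k).
Proof.
rewrite (_ : tail k = f @^-1` `]k.+1%:R, +oo[).
  by rewrite -[X in measurable X]setTI; exact: mf.
by apply/seteqP; split=> x /=; rewrite in_itv/= andbT.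
Qed.

Let tail_countE n x : (tail_count n (f x))%:E = \sum_(0 <= k < n) (\1_(tail k) x)%:E.
Proof.
rewrite /tail_count -sumEFin; apply: eq_bigr => k _; rewrite indicE.
case: ltP => fx; first by rewrite mem_set.
by rewrite memNset// /tail /=; apply/negP; rewrite -leNgt.
Qed.

Lemma layer_sum_le n : \sum_(0 <= k < n) mu (tail k) <= \int[mu]_x (f x)%:E.
Proof.
have E : \sum_(0 <= k < n) mu (tail k) = \int[mu]_x (tail_count n (f x))%:E.
  under eq_integral do rewrite tail_countE.
  rewrite ge0_integral_sum//; last first.
    by move=> k; apply/measurable_EFinP; exact: measurable_indic.
  by apply: eq_bigr => k _; rewrite integral_indic// setIT.
rewrite E; apply: ge0_le_integral => //.
- move=> x _; rewrite lee_fin; apply: sumr_ge0 => k _; by case: ifP.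
- under eq_fun do rewrite tail_countE.
  by apply: emeasurable_sum => k; apply/measurable_EFinP; exact: measurable_indic.
- exact/measurable_EFinP.
- by move=> x _; rewrite lee_fin tail_count_le.
Qed.

(** The term [mu setT] is the integral of the rounding error, which is at most one at each point. *)
Lemma le_layer_sum (c : \bar R) :
  (forall n, \sum_(0 <= k < n) mu (tail k) <= c) ->
  \int[mu]_x (f x)%:E <= mu setT + c.
Proof.
move=> hc.
have mI k : measurable_fun setT (fun x => (\1_(tail k) x)%:E : \bar R).
  by apply/measurable_EFinP; exact: measurable_indic.
apply: (@le_trans _ _ (\int[mu]_x (1 + \sum_(k <oo) (\1_(tail k) x)%:E))).
  apply: ge0_le_integral => //.
  - by move=> x _; rewrite lee_fin.
  - exact/measurable_EFinP.
  - apply: emeasurable_funD => //.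
    by apply: ge0_emeasurable_sum => // k x _ _; rewrite lee_fin.
  - move=> x _; pose n := Num.bound (f x).
    apply: (@le_trans _ _ (1 + (tail_count n (f x))%:E)).
      by rewrite -EFinD lee_fin le_tail_count// ltW// archi_boundP.
    by rewrite leeD2l// tail_countE; apply: nneseries_lim_ge => k _; rewrite lee_fin.
rewrite ge0_integralD//; last 2 first.
- by move=> x _; rewrite nneseries_ge0// => k _ _; rewrite lee_fin.
- by apply: ge0_emeasurable_sum => // k x _ _; rewrite lee_fin.
rewrite integral_cst// mul1e leeD2l// integral_nneseries//.
apply: lime_le; first by apply: is_cvg_nneseries => k _ _; exact: integral_ge0.
apply: nearW => n; under eq_bigr do rewrite integral_indic// setIT.
exact: hc.
Qed.

End LayerCake.

Lemma linear_bound_eq (R : realFieldType) (x y M : R) :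
  (forall s, 2 * s * (x - y) <= M) -> x = y.
Proof.
move=> sM; apply/eqP; rewrite -subr_eq0; apply/negPn/negP => D0.
(* For this [s] the left-hand side equals [M + 1]. *)
have := sM ((M + 1) / (2 * (x - y))).
by rewrite mulrAC mulrC divfK ?mulf_neq0// gerDl ler10.
Qed.

(** * Recovering the moments from a bound on squares *)

Section Moments.
Context {R : realType} {A : charAlgType R} (L : {scalar A}).
Hypothesis L1 : L 1 = 1.
Variable nu : {measure set (borel (character A)) -> \bar R}.
Hypothesis nu1 : nu setT = 1%E.
Local Open Scope ereal_scope.

(* The defect [1] in the hypothesis is harmless: applied to [a + s] it bounds
   [2 s (\int a - L a)] from above for all real [s]. *)
Lemma moments_of_square_bound :
  (forall c : A, \int[nu]_chi (hat (c ^+ 2) chi)%:E <= 1 + (L (c ^+ 2))%:E) ->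
  forall a : A,
    nu.-integrable setT (fun chi : borel (character A) => (hat a chi)%:E) /\
    (L a)%:E = \int[nu]_chi (hat a chi)%:E.
Proof.
move=> sq a.
have mh (c : A) : measurable_fun setT (fun chi : borel (character A) => (hat c chi)%:E).
  by apply/measurable_EFinP; exact: hat_measurable.
have isq (c : A) : nu.-integrable setT
    (fun chi : borel (character A) => (hat (c ^+ 2) chi)%:E).
  apply/integrableP; split=> //.
  under eq_integral do rewrite hatX gee0_abs ?lee_fin ?sqr_ge0// -hatX.
  by rewrite (le_lt_trans (sq c))// -EFinD ltry.
have i1 : nu.-integrable setT (fun chi : borel (character A) => (1 : \bar R)).
  have := isq 1%R; rewrite expr1n; under eq_fun do rewrite hat1; exact.
have ia : nu.-integrable setT (fun chi : borel (character A) => (hat a chi)%:E).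
  (* The absolute value of [hat a] is dominated by 1 plus its square. *)
  apply: (le_integrable _ (mh a) _ (integrableD measurableT i1 (isq a))) => //.
  move=> chi _; rewrite -EFinD !abse_EFin lee_fin hatX.
  rewrite [leRHS]ger0_norm ?addr_ge0 ?sqr_ge0//.
  rewrite -real_normK ?num_real//; set t := `|_|%R; have := sqr_ge0 (t - 1)%R.
  have t0 : (0 <= t)%R by rewrite normr_ge0.
  by rewrite sqrrB expr1n mulr1 => ?; nra.
split=> //.
pose I1 := fine (\int[nu]_chi (hat a chi)%:E).
pose I2 := fine (\int[nu]_chi (hat (a ^+ 2) chi)%:E).
have I1E : \int[nu]_chi (hat a chi)%:E = I1%:E.
  by rewrite fineK//; exact: integrable_fin_num.
have I2E : \int[nu]_chi (hat (a ^+ 2) chi)%:E = I2%:E.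
  by rewrite fineK//; exact: integrable_fin_num.
have key (s : R) : (I2 + 2 * s * I1 + s ^+ 2 <= 1 + (L (a ^+ 2) + 2 * s * L a + s ^+ 2))%R.
  have := sq (a + s%:A)%R.
  have E : ((a + s%:A) ^+ 2 = a ^+ 2 + (2 * s) *: a + (s ^+ 2)%:A)%R.
    by rewrite sqrrD exprZn expr1n mulr_algr scalerMnl mulr_natl.
  have -> : \int[nu]_chi (hat ((a + s%:A) ^+ 2)%R chi)%:E = (I2 + 2 * s * I1 + s ^+ 2)%:E.
    rewrite E; under eq_integral do rewrite !hatD hatZ hat_alg !EFinD.
    have iZ : nu.-integrable setT (fun chi : borel (character A) => (2 * s * hat a chi)%:E).
      by under eq_fun do rewrite EFinM; exact: integrableZl.
    have ic : nu.-integrable setT (fun chi : borel (character A) => (s ^+ 2)%:E).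
      have := integrableZl measurableT (s ^+ 2)%R i1.
      by under eq_fun do rewrite -EFinM mulr1.
    rewrite integralD//; last exact: integrableD.
    rewrite integralD//; under [X in _ + X + _]eq_integral do rewrite EFinM.
    rewrite integralZl// I1E I2E (integral_cst _ measurableT (s ^+ 2)%:E) nu1 mule1.
    by rewrite -EFinM -!EFinD.
  rewrite E !raddfD/= !scalarZ L1 mulr1 -EFinD lee_fin.
  exact.
rewrite I1E; congr EFin; apply/esym/(@linear_bound_eq _ _ _ (1 + L (a ^+ 2) - I2)%R) => s.
by have := key s; rewrite mulrBr; lra.
Qed.

End Moments.

(** * Prokhorov's condition and Radon measures on X(A) *)

Section PartTwo.
Context {R : realType} {A : charAlgType R} (L : {scalar A}).
Hypothesis L1 : L 1 = 1.
Implicit Types (S T : subalgClosed A) (Q : set A).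

Lemma compact_image_res S (C : set (character A)) :
  compact C -> compact (res S @` C).
Proof.
move=> cC; apply: continuous_compact => //.
by apply: continuous_subspaceT; exact: res_continuous.
Qed.

Lemma compact_borel (B : charAlgType R) (C : set (character B)) :
  compact C -> measurable (C : set (borel (character B))).
Proof.
move=> cC; apply: closed_borel; apply: compact_closed => //.
exact: character_hausdorff.
Qed.

Lemma radon_to_prokhorov Q (nu : {measure set (borel (character A)) -> \bar R}) :
  representing L (nonneg_characters Q) nu -> radon nu ->
  exists muI : measure_family A,
    (forall S, fin_gen S ->
       representing (L \o emb S)
         (nonneg_characters (inter_subalg Q S)) (muI S) /\ radon (muI S)) /\
    prokhorov muI.
Proof.
move=> nuK [_ nureg]; have nu1 := representing_mass nuK L1.
have [_ nuQ0 nuL] := nuK.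
have ex S := pushforward_exists nu (@res_measurable _ _ S).
pose mu : measure_family A := fun S => projT1 (cid (ex S)).
have muE S : forall M, mu S M = nu (res S @^-1` M).
  exact: projT2 (cid (ex S)).
have mu1 S : mu S setT = 1%E by rewrite muE.
exists mu; split=> [S fS|e e0].
  have mK := nonneg_characters_borel (inter_subalg Q S).
  have mpre (M : set (borel (character (subalg S)))) : measurable M ->
      measurable (res S @^-1` M : set (borel (character A))).
    by move=> mM; rewrite -[X in measurable X]setTI; exact: res_measurable.
  split; last first.
    have [g g_gen] := count_gen_generating (fin_gen_count fS).
    exact: (radon_character g_gen (mu1 S)).
  split=> //.
    apply/eqP; rewrite muE -measure_le0 -nuQ0; apply: le_measure; rewrite ?inE.
    - by apply: mpre; exact: measurableC.
    - by apply: measurableC; exact: nonneg_characters_borel.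
    - by move=> chi; apply: contra_not => Qchi a /Qchi.
  move=> a; have [ia La] := nuL (emb S a).
  have nuE : forall M, measurable M -> mu S M = nu (res S @^-1` M) by move=> M _.
  split; first exact/(transfer_integrable (@res_measurable _ _ S) nuE).
  by rewrite La -(transfer_integral (@res_measurable _ _ S) nuE).
(* Inner regularity of [nu] on the whole space gives one compact set for all [S], because it lies in
   the preimage of its own restriction. *)
have : ((1 - e)%:E < nu setT)%E by rewrite nu1 lte_fin ltrBlDr ltrDl.
rewrite nureg// => /ereal_sup_gt[_ [C [cC _] <-] eC].
exists C => // S fS; apply: (le_trans (ltW eC)); rewrite muE.
apply: le_measure; rewrite ?inE; first exact: compact_borel.
  rewrite -[X in measurable X]setTI; apply: res_measurable => //.
  by apply: compact_borel; exact: compact_image_res.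
by move=> chi Cchi; exists chi.
Qed.

Section ProkhorovToRadon.
Variables (Q : set A) (muI : measure_family A).
Hypothesis muI_rep : forall S, fin_gen S ->
  representing (L \o emb S) (nonneg_characters (inter_subalg Q S)) (muI S).
Hypothesis muI_prokhorov : prokhorov muI.

(** The tail filter of the finite subsets [H] of [A] directed by inclusion; along it, any given
    element eventually lies in [gen H]. *)
Definition finite_sets_filter : set_system (set A) :=
  filter_from [set G | finite_set G] (fun G => [set H | finite_set H /\ G `<=` H]).

Lemma finite_sets_proper : ProperFilter finite_sets_filter.
Proof.
apply: filter_from_proper; last by move=> G fG; exists G; split.
apply: filter_from_filter; first by exists set0; exact: finite_set0.
move=> G H fG fH; exists (G `|` H); first by rewrite /= finite_setU.
by move=> H' [fH' GH]; split; split => // a Ga; apply: GH; [left|right].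
Qed.

Let outer (H : set A) : set (character A) -> \bar R :=
  image_outer (res (gen H) : character A -> borel (character (subalg (gen H))))
    (muI (gen H)).

Let muI1 H : finite_set H -> muI (gen H) setT = 1%E.
Proof. by move=> fH; apply: (representing_mass (muI_rep (fin_gen_gen fH))). Qed.

Let outer_le1 H B : finite_set H -> (outer H B <= 1)%E.
Proof. by move=> fH; rewrite -(muI1 fH); exact: image_outer_le. Qed.

Let outer_fin H B : finite_set H -> outer H B \is a fin_num.
Proof.
move=> fH; rewrite ge0_fin_numE ?image_outer_ge0//.
by rewrite (le_lt_trans (outer_le1 _ fH))// ltry.
Qed.

Variable U : set_system (set A).
Hypothesis ultraU : UltraFilter U.
Hypothesis finU : finite_sets_filter `<=` U.

Let properU : ProperFilter U.
Proof. exact: ultra_proper. Qed.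

#[local] Existing Instance properU.

Let eventually G : finite_set G -> \forall H \near U, finite_set H /\ G `<=` H.
Proof. by move=> fG; apply: finU; exists G. Qed.

Let finite_eventually : \forall H \near U, finite_set H.
Proof. by apply: filterS (eventually (finite_set0 A)) => H []. Qed.

Lemma outer_limit B : exists l : R, fine (outer H B) @[H --> U] --> l.
Proof.
have [|l _ Ul] := ultra_cvg_compact ultraU (@segment_compact _ 0 1)
    (f := fun H => fine (outer H B)); last by exists l.
apply: filterS finite_eventually => H fH /=.
rewrite in_itv/= -!lee_fin fineK ?outer_fin// outer_le1// andbT.
exact: image_outer_ge0.
Qed.

(* The [muI S] need not be compatible, so no single [muI S] determines the limit;
   cylinder sets are Caratheodory measurable for it because each of them is
   eventually a preimage under [res (gen H)]. *)
Let l B : R := projT1 (cid (outer_limit B)).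

Let Ul B : fine (outer H B) @[H --> U] --> l B.
Proof. exact: projT2 (cid (outer_limit B)). Qed.

Let limit_le (f g : set A -> R) (x y : R) : f H @[H --> U] --> x -> g H @[H --> U] --> y ->
  (\forall H \near U, f H <= g H) -> x <= y.
Proof.
move=> fx gy fg; have gfx : g H - f H @[H --> U] --> y - x by exact: cvgB.
rewrite -subr_ge0 -(cvg_lim (@Rhausdorff R) gfx); apply: limr_ge; first exact: cvgP gfx.
by apply: filterS fg => H; rewrite subr_ge0.
Qed.

Let m B : \bar R := (l B)%:E.

Let m_caratheodory (a : A) (M : set R) : measurable M ->
  m.-caratheodory [set chi | M (hat a chi)].
Proof.
move=> mM D; rewrite /m -EFinD; congr EFin.
apply: (@cvg_unique _ (@Rhausdorff R) _ _ _ _ (@Ul D)).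
pose V := [set chi : character A | M (hat a chi)]; rewrite -/V.
have sumU : fine (outer H (D `&` V)) + fine (outer H (D `&` ~` V)) @[H --> U]
    --> l (D `&` V) + l (D `&` ~` V) by exact: cvgD.
apply: cvg_trans sumU; apply: near_eq_cvg.
apply: filterS (eventually (finite_set1 a)) => H [fH aH].
have aG : a \in gen H by apply: gen_mem; exact: aH.
pose a' : subalg (gen H) := Sub a aG.
have mM' : measurable (hat a' @^-1` M : set (borel (character (subalg (gen H))))).
  by rewrite -[X in measurable X]setTI; exact: hat_measurable.
have := image_outer_caratheodory (res (gen H) : character A -> borel _) (muI (gen H)) mM' D.
by rewrite -/(outer H _) => ->; rewrite fineD ?outer_fin.
Qed.

Let m_tight (e : R) : 0 < e -> exists2 C, compact C & ((1 - e)%:E <= m C)%E.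
Proof.
move=> e0; have [C cC eC] := muI_prokhorov e0; exists C => //.
rewrite lee_fin; apply: (limit_le (cvg_cst _) (@Ul C)).
apply: filterS finite_eventually => H fH; rewrite -lee_fin fineK ?outer_fin//.
rewrite (le_trans (eC _ (fin_gen_gen fH)))// /outer /image_outer measurable_mu_extE//.
by apply: compact_borel; exact: compact_image_res.
Qed.

Let outer_le H (a : subalg (gen H)) (M : set R) : measurable M ->
  (outer H [set chi | M (hat (emb (gen H) a) chi)] <= muI (gen H) (hat a @^-1` M))%E.
Proof.
move=> mM; apply: image_outer_le => //.
by rewrite -[X in measurable X]setTI; exact: hat_measurable.
Qed.

Let m0 : m set0 = 0%E.
Proof.
congr EFin; apply/eqP; rewrite eq_le; apply/andP; split.
  apply: (limit_le (@Ul _) (cvg_cst 0)); apply: nearW => H.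
  by rewrite /outer image_outer0.
apply: (limit_le (cvg_cst 0) (@Ul _)); apply: nearW => H.
by rewrite /outer image_outer0.
Qed.

Let le_m : {homo m : B C / B `<=` C >-> (B <= C)%E}.
Proof.
move=> B C BC; rewrite lee_fin; apply: (limit_le (@Ul _) (@Ul _)).
apply: filterS finite_eventually => H fH.
by rewrite fine_le ?outer_fin//; exact: le_image_outer.
Qed.

Let mU B C : (m (B `|` C) <= m B + m C)%E.
Proof.
rewrite /m -EFinD lee_fin; apply: (limit_le (@Ul _) (cvgD (@Ul _) (@Ul _))).
apply: filterS finite_eventually => H fH.
rewrite -fineD ?outer_fin// fine_le ?fin_numD ?outer_fin//.
exact: outer_measureU2.
Qed.

Let mT : (m setT <= 1)%E.
Proof.
rewrite lee_fin; apply: (limit_le (@Ul setT) (cvg_cst (1 : R))).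
apply: filterS finite_eventually => H fH.
by rewrite -lee_fin fineK ?outer_fin// outer_le1.
Qed.

Let mem_eventually (a : A) : \forall H \near U, finite_set H /\ a \in gen H.
Proof.
apply: filterS (eventually (finite_set1 a)) => H [fH aH]; split => //.
by apply: gen_mem; exact: aH.
Qed.

(** Once [c] lies in [gen H], the outer values of the tails are at most their [muI (gen H)] masses,
    and the layer-cake sum of these is at most the integral of the square, which is [L (c ^+ 2)].
    The bound survives the limit. *)
Let m_square (c : A) n :
  (\sum_(0 <= k < n) m [set chi | (k.+1%:R < hat (c ^+ 2) chi)%R] <= (L (c ^+ 2))%:E)%E.
Proof.
rewrite /m sumEFin lee_fin.
pose M k := [set y : R | k.+1%:R < y].
pose tail k := [set chi : character A | M k (hat (c ^+ 2) chi)].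
have sumU : \sum_(0 <= k < n) fine (outer H (tail k)) @[H --> U]
    --> \sum_(0 <= k < n) l (tail k).
  by apply: cvg_big => [|k _]; [exact: add_continuous|exact: Ul].
apply: (limit_le sumU (cvg_cst _)).
apply: filterS (mem_eventually c) => H [fH cH].
rewrite -lee_fin -sumEFin; pose c' : subalg (gen H) := Sub c cH.
have c'E : emb (gen H) (c' ^+ 2) = c ^+ 2 by exact: (rmorphXn (emb (gen H)) 2 c').
have [_ _ /(_ (c' ^+ 2))[_]] := muI_rep (fin_gen_gen fH).
rewrite [(_ \o _) _]/= c'E => ->.
have c'0 chi : 0 <= hat (c' ^+ 2) chi by rewrite hatX sqr_ge0.
apply: le_trans (layer_sum_le (muI (gen H)) (@hat_measurable _ _ (c' ^+ 2)) c'0 n).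
apply: lee_sum => k _; rewrite fineK ?outer_fin//.
by rewrite /tail -c'E; apply: outer_le; apply: open_measurable; exact: open_gt.
Qed.

(** Once [a] lies in [gen H], the set where it is negative is disjoint from the support of
    [muI (gen H)]. *)
Let m_null (a : A) : Q a -> m [set chi | hat a chi < 0] = 0%E.
Proof.
move=> Qa; apply/eqP; rewrite eq_le -[X in _ && (X <= _)%E]m0 le_m ?andbT//.
rewrite lee_fin; apply: (limit_le (@Ul _) (cvg_cst 0)).
apply: filterS (mem_eventually a) => H [fH aH].
rewrite -lee_fin fineK ?outer_fin//.
pose a' : subalg (gen H) := Sub a aH.
apply: (le_trans (outer_le a' (open_measurable (@open_lt R 0)))).
have [_ muQ _] := muI_rep (fin_gen_gen fH).
rewrite -[leRHS]muQ.
apply: le_measure; rewrite ?inE.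
- by apply: open_borel; exact: open_hat_lt.
- by apply: measurableC; exact: nonneg_characters_borel.
move=> chi chi0 /(_ a'); rewrite leNgt chi0 => /(_ _)/negP; apply => //.
Qed.

Lemma prokhorov_radon_ultra :
  exists nu : {measure set (borel (character A)) -> \bar R},
    representing L (nonneg_characters Q) nu /\ radon nu.
Proof.
have [|||||W chi oW Wchi||nu [radnu nu1 nuW _]] :=
  @radon_of_content R (character A) m.
- exact: character_hausdorff.
- exact: m0.
- exact: le_m.
- exact: mU.
- exact: mT.
- have [a /= [xV cV VW]] := character_regular oW Wchi.
  exists [set psi | hat a psi <= 2^-1]; split => //.
  apply: (m_caratheodory a (M := [set y : R | y <= 2^-1])).
  by apply: closed_measurable; exact: closed_le.
- exact: m_tight.
exists nu; split=> //.
have mnu := moments_of_square_bound L1 nu1.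
split.
- exact: nonneg_characters_borel.
- case: radnu => _ ->; last first.
    by apply: measurableC; exact: nonneg_characters_borel.
  apply/eqP; rewrite eq_le; apply/andP; split; last first.
    by apply: ereal_sup_ubound; exists set0; [split => //; exact: compact0|].
  apply: ge_ereal_sup => _ [C [cC CQ] <-].
  (* Inner regularity has reduced the support condition to compact [C]. Asking for an open null
     superset keeps the sets measurable and lets the bound of [nu] by [m] on open sets be used. *)
  pose P V := exists2 W, open W /\ V `<=` W & nu W = 0%E.
  have [||chi /CQ|V [W [oW VW] W0] CV] := @compact_ind _ C P cC.
  + by exists set0; [split => //; exact: open0|rewrite measure0].
  + move=> V1 V2 [W1 [oW1 VW1] W10] [W2 [oW2 VW2] W20].
    exists (W1 `|` W2); first by split; [exact: openU|exact: setUSS].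
    apply/eqP; rewrite -measure_le0.
    rewrite (le_trans (measureU2 _ (open_borel oW1) (open_borel oW2)))//.
    by rewrite [X in (X + _)%E]W10 [X in (_ + X)%E]W20 adde0.
  + move=> /existsNP[a /not_implyP[Qa /negP]]; rewrite -ltNge => a0.
    have oa := open_hat_lt a 0.
    exists [set psi | hat a psi < 0]; first by apply: open_nbhs_nbhs; split.
    exists [set psi | hat a psi < 0]; first by split.
    by apply/eqP; rewrite -measure_le0 -(m_null Qa) nuW.
  rewrite -W0; apply: le_measure; rewrite ?inE; [exact: compact_borel|exact: open_borel|].
  exact: subset_trans CV (subset_trans (@interior_subset _ V) VW).
- apply: mnu => c.
  have := @le_layer_sum _ _ _ nu (hat (c ^+ 2))
    (@hat_measurable _ _ (c ^+ 2)) _ (L (c ^+ 2))%:E.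
  rewrite nu1; apply => [chi|n]; first by rewrite hatX sqr_ge0.
  (* The tails are open, so their [nu] masses are bounded by [m]. *)
  apply: le_trans (m_square c n); apply: lee_sum => k _.
  by apply: nuW; exact: open_hat_gt.
Qed.

End ProkhorovToRadon.
Lemma prokhorov_to_radon Q (muI : measure_family A) :
  (forall S, fin_gen S ->
    representing (L \o emb S) (nonneg_characters (inter_subalg Q S)) (muI S)) ->
  prokhorov muI ->
  exists nu : {measure set (borel (character A)) -> \bar R},
    representing L (nonneg_characters Q) nu /\ radon nu.
Proof.
move=> muI_rep muI_prok.
have [U [ultraU finU]] := ultraFilterLemma finite_sets_proper.
exact: (prokhorov_radon_ultra muI_rep muI_prok ultraU finU).
Qed.

End PartTwo.

Theorem corollary3p11 (R : realType) (A : charAlgType R) (L : {scalar A})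
    (L1 : L 1 = 1) (K : set (character A)) (clK : closed K) :
  (exists2 Q : set A, quadratic_module Q & K = nonneg_characters Q) /\
  forall Q : set A, quadratic_module Q -> K = nonneg_characters Q ->
  [/\ (exists mu : {measure set (g_sigma_algebraType (cylinder A)) -> \bar R},
         representing L setT mu /\
         forall S : subalgClosed A, fin_gen S ->
           representing L
             (res S @^-1` nonneg_characters (inter_subalg Q S)) mu)
      <->
      (exists muI : measure_family A,
         [/\ forall S : subalgClosed A, fin_gen S ->
               representing (L \o emb S)
                 (nonneg_characters (inter_subalg Q S)) (muI S) /\
               radon (muI S),
             exact_system fin_gen muI &
             exists2 muL : measure_family A,
               corresponding_system muI muL & thick muL]),
      count_gen_qm Q ->
      forall mu : {measure set (g_sigma_algebraType (cylinder A)) -> \bar R},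
        representing L setT mu ->
        (forall S : subalgClosed A, fin_gen S ->
           representing L
             (res S @^-1` nonneg_characters (inter_subalg Q S)) mu) ->
        representing L K mu &
      (exists nu : {measure set (borel (character A)) -> \bar R},
         representing L K nu /\ radon nu)
      <->
      (exists muI : measure_family A,
         (forall S : subalgClosed A, fin_gen S ->
            representing (L \o emb S)
              (nonneg_characters (inter_subalg Q S)) (muI S) /\
            radon (muI S)) /\
         prokhorov muI)].
Proof.
split.
  exists [set a | forall chi, K chi -> 0 <= hat a chi]; last exact: closed_is_nonneg.
  split=> [chi _|a b Qa Qb chi Kchi|a b Qb chi Kchi].
  - by rewrite hat1.
  - by rewrite hatD addr_ge0// ?Qa ?Qb.
  - by rewrite hatM hatX mulr_ge0 ?sqr_ge0// Qb.
move=> Q _ ->; split.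
- split=> [[mu [muL muQ]]|[muI [muI_rep _ [muL corr muL_thick]]]].
    exact: (cylinder_to_systems L1 muL muQ).
  by apply: (systems_to_cylinder corr muL_thick) => S fS; exact: (muI_rep S fS).1.
- by move=> cQ mu muL muQ; exact: cylinder_support_count_gen.
- split=> [[nu [nuK nu_radon]]|[muI [muI_rep muI_prokhorov]]].
    exact: (radon_to_prokhorov L1 nuK nu_radon).
  by apply: (prokhorov_to_radon L1 _ muI_prokhorov) => S fS; exact: (muI_rep S fS).1.
Qed.
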